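(* Let $\Gamma\supseteq\Lambda$ be artin algebras. Then: (1) $\dim(\mathrm{mod}\,\Lambda)\geq\dim(\mathrm{mod}\,\Gamma)$ if $\Gamma\geq\Lambda$ is a weak excellent extension, and $\dim(\mathrm{mod}\,\Lambda)=\dim(\mathrm{mod}\,\Gamma)$ if $\Gamma\geq\Lambda$ is an excellent extension; (2) $\dim(\mathrm{mod}\,\Lambda)\leq\dim(\mathrm{mod}\,\Gamma)+2$ if $\Gamma\geq\Lambda$ is a left idealized extension.
   Context: $\mathrm{mod}\,\Lambda$ is the category of finitely generated right $\Lambda$-modules. If $\Lambda$ is a subring of a ring $\Gamma$ with the same identity, then $\Gamma$ is called a ring extension of $\Lambda$, denoted $\Gamma\geq\Lambda$. Write $N\mid M$ for ''$N$ is a direct summand of $M$''. A ring extension $\Gamma\geq\Lambda$ is called: - a weak excellent extension if (1.1) $\Gamma$ is $\Lambda$-projective, i.e. for a submodule $N_\Gamma$ of $M_\Gamma$, if $N_\Lambda\mid M_\Lambda$ then $N_\Gamma\mid M_\Gamma$; (1.2) $\Gamma$ is a finite extension of $\Lambda$, i.e. there is a finite set $\{\gamma_1,\dots,\gamma_n\}\subseteq\Gamma$ with $\Gamma=\sum_{i=1}^n\gamma_i\Lambda$; (1.3) $\Gamma_\Lambda$ is flat and ${}_\Lambda\Gamma$ is projective; - an excellent extension if it is a weak excellent extension and $\Gamma_\Lambda$ and ${}_\Lambda\Gamma$ are free with a common basis $\{\gamma_1,\dots,\gamma_n\}$ such that $\Lambda\gamma_i=\gamma_i\Lambda$ for all $1\le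 i\le n$; - a left idealized extension if the Jacobson radical $\mathrm{rad}\,\Lambda$ is a left ideal of $\Gamma$. Extension dimension: let $\mathcal{A}$ be an abelian category. For a class $\mathcal{U}$ of objects, $\mathrm{add}\,\mathcal{U}$ is the full subcategory of direct summands of finite direct sums of objects of $\mathcal{U}$. For subcategories $\mathcal{U}_1,\mathcal{U}_2$, $\mathcal{U}_1\diamond\mathcal{U}_2:=\mathrm{add}\{A\in\mathcal{A}\mid \text{there is an exact sequence } 0\to U_1\to A\to U_2\to 0 \text{ with } U_1\in\mathcal{U}_1, U_2\in\mathcal{U}_2\}$. For $T\in\mathcal{A}$: $\langle T\rangle_0=0$, $\langle T\rangle_1=\mathrm{add}\,T$, $\langle T\rangle_n=\langle T\rangle_1\diamond\langle T\rangle_{n-1}$ for $n\ge 2$. Then $\dim\mathcal{A}:=\inf\{n\ge 0\mid \mathcal{A}=\langle T\rangle_{n+1}\text{ for some }T\in\mathcal{A}\}$ (with $\inf\emptyset=+\infty$). *)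

(* Defs.v *)
From HB Require Import structures.
From mathcomp Require Import all_boot all_order all_algebra.
From mathcomp Require Import boolp classical_sets constructive_ereal.
Set Implicit Arguments.
Unset Strict Implicit.
Unset Printing Implicit Defensive.
Import Order.TTheory GRing.Theory Num.Theory.
Local Open Scope ring_scope.

(* A right A-module is an [lmodType A^c], where A^c is the converse ring:
   x . a is written [(a : A^c) *: x]. *)

Definition submodule (A : pzRingType) (M : lmodType A) (N : {pred M}) : Prop :=
  submod_closed N.

Definition finitely_generated (A : pzRingType) (M : lmodType A) : Prop :=
  exists (n : nat) (g : 'I_n -> M),
    forall x : M, exists c : 'I_n -> A, x = \sum_i c i *: g i.

Definition is_basis (A : pzRingType) (M : lmodType A) (n : nat)
    (g : 'I_n -> M) : Prop :=
  forall x : M, exists! c : {ffun 'I_n -> A}, x = \sum_i c i *: g i.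

(* The submodule N of M has a complement that is itself a submodule. *)
Definition has_complement (A : pzRingType) (M : lmodType A) (N : {pred M}) :
    Prop :=
  exists L : {pred M},
    [/\ submodule L,
        forall x, x \in N -> x \in L -> x = 0 &
        forall x, exists y z, [/\ y \in N, z \in L & x = y + z]].

Definition projective (A : pzRingType) (P : lmodType A) : Prop :=
  forall (M N : lmodType A) (g : {linear M -> N}) (f : {linear P -> N}),
    (forall y, exists x, g x = y) ->
    exists h : {linear P -> M}, forall p, g (h p) = f p.

Definition balanced (A : pzRingType) (M : lmodType A^c) (N : lmodType A)
    (T : zmodType) (t : M -> N -> T) : Prop :=
  [/\ forall x x' y, t (x + x') y = t x y + t x' y,
      forall x y y', t x (y + y') = t x y + t x y' &
      forall (a : A) x y, t ((a : A^c) *: x) y = t x (a *: y)].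

(* (T, t) is a tensor product of the right module M and the left module N. *)
Definition is_tensor (A : pzRingType) (M : lmodType A^c) (N : lmodType A)
    (T : zmodType) (t : M -> N -> T) : Prop :=
  balanced t /\
  forall (Z : zmodType) (b : M -> N -> Z), balanced b ->
    (exists h : {additive T -> Z}, forall x y, h (t x y) = b x y) /\
    (forall h h' : {additive T -> Z},
       (forall x y, h (t x y) = b x y) -> (forall x y, h' (t x y) = b x y) ->
       h =1 h').

(* Tensoring with M preserves injections of left modules: h below is the map
   induced by f between the tensor products T and T'. *)
Definition flat (A : pzRingType) (M : lmodType A^c) : Prop :=
  forall (N N' : lmodType A) (f : {linear N -> N'}), injective f ->
  forall (T T' : zmodType) (t : M -> N -> T) (t' : M -> N' -> T'),
    is_tensor t -> is_tensor t' ->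
  forall h : {additive T -> T'},
    (forall x y, h (t x y) = t' x (f y)) -> injective h.

Definition restr (A B : pzRingType) (f : {rmorphism A -> B})
    (M : lmodType B) : Type := M.

Section RestrictionOfScalars.
Context (A B : pzRingType) (f : {rmorphism A -> B}) (M : lmodType B).

HB.instance Definition _ := GRing.Zmodule.copy (restr f M) M.

Let scale (a : A) (x : restr f M) : restr f M := f a *: (x : M).

Fact restr_scaleA a b x : scale a (scale b x) = scale (a * b) x.
Proof. by rewrite /scale scalerA rmorphM. Qed.

Fact restr_scale1 : left_id 1 scale.
Proof. by move=> x; rewrite /scale rmorph1 scale1r. Qed.

Fact restr_scaleDr : right_distributive scale +%R.
Proof. by move=> a x y; rewrite /scale; exact: scalerDr. Qed.

Fact restr_scaleDl x : {morph scale^~ x : a b / a + b}.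
Proof. by move=> a b; rewrite /scale rmorphD; exact: scalerDl. Qed.

HB.instance Definition _ := GRing.Zmodule_isLmodule.Build A (restr f M)
  restr_scaleA restr_scale1 restr_scaleDr restr_scaleDl.

End RestrictionOfScalars.

Definition converse_mor (A B : pzRingType) (f : A -> B) : A^c -> B^c := f.

Section ConverseMorphism.
Context (A B : pzRingType) (f : {rmorphism A -> B}).

Fact converse_mor_is_zmod_morphism : zmod_morphism (converse_mor f).
Proof. by move=> x y; exact: (raddfB f). Qed.

Fact converse_mor_is_monoid_morphism : monoid_morphism (converse_mor f).
Proof. by split=> [|x y]; [exact: (rmorph1 f) | exact: (rmorphM f)]. Qed.

HB.instance Definition _ := GRing.isZmodMorphism.Build A^c B^c
  (converse_mor f) converse_mor_is_zmod_morphism.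
HB.instance Definition _ := GRing.isMonoidMorphism.Build A^c B^c
  (converse_mor f) converse_mor_is_monoid_morphism.

End ConverseMorphism.

Definition right_restr (L G : pzRingType) (f : {rmorphism L -> G})
    (M : lmodType G^c) : lmodType L^c :=
  @restr L^c G^c (converse_mor f) M.

Definition artinian (R : comNzRingType) : Prop :=
  forall I : nat -> {pred R^o},
    (forall n, submodule (I n)) -> (forall n, {subset I n.+1 <= I n}) ->
    exists n, forall m, (n <= m)%N -> I m =i I n.

Definition artin_algebra (R : comNzRingType) (A : algType R) : Prop :=
  artinian R /\ finitely_generated A.

Definition maximal_right_ideal (A : pzRingType) (I : {pred (A^c)^o}) : Prop :=
  [/\ submodule I, exists x, x \notin I &
      forall J : {pred (A^c)^o}, submodule J -> {subset I <= J} ->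
        (exists x, x \notin J) -> {subset J <= I}].

(* Intersection of the maximal right ideals of A. *)
Definition jacobson_radical (A : pzRingType) : {pred A} :=
  fun x => `[< forall I : {pred (A^c)^o}, maximal_right_ideal I -> x \in I >].

Arguments jacobson_radical A : clear implicits.

Section RingExtensions.
(* The extension G >= L is given by the embedding f of L into G. *)
Context (L G : pzRingType) (f : {rmorphism L -> G}).

Definition right_reg : lmodType L^c := right_restr f ((G^c)^o : lmodType G^c).
Definition left_reg : lmodType L := restr f (G^o : lmodType G).

Definition relatively_projective : Prop :=
  forall (M : lmodType G^c) (N : {pred M}), submodule N ->
    has_complement (N : {pred right_restr f M}) -> has_complement N.

Definition weak_excellent : Prop :=
  [/\ relatively_projective,
      finitely_generated right_reg,
      flat right_reg &
      projective left_reg].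

Definition excellent : Prop :=
  weak_excellent /\
  exists (n : nat) (g : 'I_n -> G),
    [/\ is_basis (g : 'I_n -> right_reg),
        is_basis (g : 'I_n -> left_reg) &
        forall i, range (fun l => f l * g i) = range (fun l => g i * f l)].

Definition left_idealized : Prop :=
  @submodule G G^o
    (fun x => `[< exists2 l : L, l \in jacobson_radical L & f l = x >]).

End RingExtensions.

Record fgmod (A : pzRingType) := FGMod {
  fgmod_sort :> lmodType A;
  fgmodP : finitely_generated fgmod_sort
}.

Section ExtensionDimension.
Context (A : pzRingType).

Fixpoint dsum (V : nat -> fgmod A) (n : nat) : lmodType A :=
  if n is n'.+1 then (dsum V n' * V n')%type else 'rV[A]_0.

Definition summand (N M : lmodType A) : Prop :=
  exists (L : lmodType A) (h : {linear M -> (N * L)%type}), bijective h.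

(* Classes of objects are predicates rather than [set]s, whose universe is
   too small for them. *)
Definition add (U : fgmod A -> Prop) (M : fgmod A) : Prop :=
  exists (n : nat) (V : nat -> fgmod A),
    (forall i, (i < n)%N -> U (V i)) /\ summand M (dsum V n).

Definition short_exact (M1 M M2 : lmodType A)
    (u : {linear M1 -> M}) (v : {linear M -> M2}) : Prop :=
  [/\ injective u,
      forall x, v x = 0 <-> exists y, u y = x &
      forall z, exists x, v x = z].

Definition diamond (U1 U2 : fgmod A -> Prop) : fgmod A -> Prop :=
  add (fun M => exists (M1 M2 : fgmod A)
                  (u : {linear M1 -> M}) (v : {linear M -> M2}),
         [/\ U1 M1, U2 M2 & short_exact u v]).

Fixpoint layer (T : fgmod A) (n : nat) : fgmod A -> Prop :=
  match n with
  | 0 => fun M => forall x : M, x = 0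
  | 1 => add (fun M => M = T)
  | n'.+1 => diamond (add (fun M => M = T)) (layer T n')
  end.

Definition generated_in (n : nat) : Prop :=
  exists T : fgmod A, forall M : fgmod A, layer T n.+1 M.

Fact generated_in_exP :
  (exists n, generated_in n) -> exists n, `[< generated_in n >].
Proof. by move=> [n ?]; exists n; apply/asboolP. Qed.

(* Least n with [generated_in n], and +oo if there is none.  Extended
   natural numbers are taken in [\bar int]. *)
Definition extension_dim : \bar int :=
  if pselect (exists n, generated_in n) is left e
  then (ex_minn (generated_in_exP e))%:Z%:E
  else +oo%E.

End ExtensionDimension.

(* Extension dimension of the category of finitely generated right modules. *)
Definition dim_mod (A : pzRingType) : \bar int := extension_dim A^c.

(* Main.v *)
Require Import Defs.
From HB Require Import structures.
From mathcomp Require Import all_boot all_order all_algebra.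
From mathcomp Require Import boolp classical_sets constructive_ereal functions.
Set Implicit Arguments.
Unset Strict Implicit.
Unset Printing Implicit Defensive.
Import Defs Order.TTheory GRing.Theory Num.Theory.
Local Open Scope ring_scope.

(** Right modules over a ring L are left modules over its converse ring, so
    everything below is about left modules; A and B are the converses of the
    smaller and of the larger algebra.

    The relation of being a direct summand is that of being a retract, and an
    additive exact functor carries finite direct sums, retracts and extensions
    to such; hence it carries the n-th layer of T into the n-th layer of the
    image of T ([functor_layer]).  A comparison of extension dimensions is thus
    a way of reaching every module of one category, up to summands and a fixed
    number of extensions by fixed modules, from the image of such a functor.

    Weak excellent extensions.  The larger algebra is finitely generated
    projective over the smaller one on the side that makes M |-> B (x)_A M
    exact; the functor is realised on coordinate vectors through a dual basis
    ([induction]).  The counit B (x)_A M -> M of a B-module M is split over A by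
    m |-> 1 (x) m, so relative projectivity splits it over B, and M is a summand
    of an induced module ([weak_excellent_generated]).

    Excellent extensions.  The functor used for the other inequality is
    restriction.  A basis element g that normalizes the smaller algebra twists
    it by an automorphism s, given by g l = s(l) g.  After twisting M by the
    inverse of s, the coordinate along g makes M a summand of the restriction of
    an induced module ([excellent_generated]).

    Left idealized extensions.  Let J be the radical of the smaller algebra.
    Since J is a left ideal of the larger algebra, H = Hom(J, M) is a module
    over the larger algebra, and mu : M -> H sends m to the map j |-> m j.  The
    kernel X of mu is killed by J, and so is its cokernel, because j in J sends h
    in H to the image under mu of the value of h at j ([rad_cokernel]).  Thus
    X is a summand of a power of the top A/J ([semisimple_top]), the image I of
    mu is a summand of I + P for a free module P mapping onto H, and I + P is an
    extension of H by the preimage K of I in P ([preimage_exact]).  As K contains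
    J P, it is a summand of a power of J + A ([radical_syzygy]).  So M is reached
    from the restriction of H by two more extensions by fixed modules, which is
    the constant 2.

    The modules J, X, I, K and H are finitely generated because an artinian
    commutative ring is noetherian ([hopkins]). *)

(** * Submodules and quotient modules *)

Section LinearOf.
Context (A : pzRingType) (M N : lmodType A) (h : M -> N).
Hypothesis h_lin : linear h.

Definition linear_of : {linear M -> N} :=
  HB.pack h (GRing.isLinear.Build A M N *:%R h h_lin).

End LinearOf.

Definition sep (T : Type) (P : T -> Prop) : {pred T} := fun x => `[< P x >].

Lemma sepP (T : Type) (P : T -> Prop) x : reflect (P x) (x \in sep P).
Proof. exact: asboolP. Qed.

Section Submodules.
Context (A : pzRingType) (M : lmodType A) (N : {pred M}).
Hypothesis hN : submodule N.

Lemma submodule0 : 0 \in N. Proof. by case: hN. Qed.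

Lemma submoduleP a x y : x \in N -> y \in N -> a *: x + y \in N.
Proof. by move=> Nx Ny; case: hN => _; apply. Qed.

Lemma submoduleD x y : x \in N -> y \in N -> x + y \in N.
Proof. by move=> Nx Ny; rewrite -[x]scale1r; exact: submoduleP. Qed.

Lemma submoduleZ a x : x \in N -> a *: x \in N.
Proof. by move=> Nx; rewrite -[_ *: _]addr0; exact/submoduleP/submodule0. Qed.

Lemma submoduleB x y : x \in N -> y \in N -> x - y \in N.
Proof. by move=> Nx Ny; rewrite addrC -scaleN1r; exact: submoduleP. Qed.

Lemma submodule_sum (I : finType) (c : I -> A) (g : I -> M) :
  (forall i, g i \in N) -> \sum_i c i *: g i \in N.
Proof.
move=> Ng; elim/big_rec: _ => [|i x _]; first exact: submodule0.
exact/submoduleP.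
Qed.

End Submodules.

Section ImagePreimage.
Context (A : pzRingType) (M X : lmodType A) (u : {linear M -> X}).

Definition image_of (N : {pred M}) : {pred X} :=
  sep (fun y : X => exists2 x : M, x \in N & u x = y).

Definition preim_of (N : {pred X}) : {pred M} := sep (fun x : M => u x \in N).

Definition ker_of (N : {pred M}) : {pred M} :=
  sep (fun x : M => x \in N /\ u x = 0).

Lemma image_ofP N y : reflect (exists2 x, x \in N & u x = y) (y \in image_of N).
Proof. exact: sepP. Qed.

Lemma preim_ofP N x : reflect (u x \in N) (x \in preim_of N).
Proof. exact: sepP. Qed.

Lemma ker_ofP N x : reflect (x \in N /\ u x = 0) (x \in ker_of N).
Proof. exact: sepP. Qed.

Lemma image_submodule N : submodule N -> submodule (image_of N).
Proof.
move=> hN; split; first by apply/image_ofP; exists 0; rewrite ?linear0 ?submodule0.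
move=> a _ _ /image_ofP[x Nx <-] /image_ofP[y Ny <-]; apply/image_ofP.
by exists (a *: x + y); rewrite ?linearP//; exact: submoduleP.
Qed.

Lemma preim_submodule N : submodule N -> submodule (preim_of N).
Proof.
move=> hN; split; first by apply/preim_ofP; rewrite linear0 submodule0.
by move=> a x y /preim_ofP Nx /preim_ofP Ny; apply/preim_ofP; rewrite linearP submoduleP.
Qed.

Lemma ker_of_submodule N : submodule N -> submodule (ker_of N).
Proof.
move=> hN; split; first by apply/ker_ofP; rewrite linear0 submodule0.
move=> a x y /ker_ofP[Nx ux] /ker_ofP[Ny uy]; apply/ker_ofP.
by rewrite linearP ux uy scaler0 addr0; split=> //; exact: submoduleP.
Qed.

End ImagePreimage.

Section Submod.
Context (A : pzRingType) (M : lmodType A) (N : {pred M}).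

(** The proof argument is what lets N carry the closure instances below. *)
Definition submod_pred of submodule N : {pred M} := N.

Variable hN : submodule N.

HB.instance Definition _ :=
  GRing.isSubmodClosed.Build A M (submod_pred hN)
    (GRing.submod_closed_semi hN).

Definition submod : Type := {x : M | submod_pred hN x}.
HB.instance Definition _ := SubType.on submod.
HB.instance Definition _ := Choice.on submod.
HB.instance Definition _ := [SubChoice_isSubZmodule of submod by <:].
HB.instance Definition _ := [SubZmodule_isSubLmodule of submod by <:].

Lemma submod_val_linear : linear (val : submod -> M).
Proof. by move=> a x y; rewrite linearP. Qed.

Definition submod_val := linear_of submod_val_linear.

Lemma submod_valP (x : submod) : submod_val x \in N.
Proof. exact: valP x. Qed.

Lemma submod_val_inj : injective submod_val.
Proof. exact: val_inj. Qed.

Lemma submod_valK (x : M) : x \in N -> exists y : submod, submod_val y = x.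
Proof. by move=> Nx; exists (exist _ x Nx). Qed.

Lemma lift_submod (X : lmodType A) (h : {linear X -> M}) :
  (forall x, h x \in N) ->
  exists h' : {linear X -> submod}, forall x, submod_val (h' x) = h x.
Proof.
move=> hN'; pose h' x : submod := exist _ (h x) (hN' x).
have h'_lin : linear h'.
  move=> a x y; apply: submod_val_inj; rewrite linearP; exact: linearP.
by exists (linear_of h'_lin).
Qed.

End Submod.

Section QuotientModule.
Context (A : pzRingType) (M : lmodType A) (N : {pred M}) (hN : submodule N).

Definition quotmod : Type := Quotient.quot (submod_pred hN).
HB.instance Definition _ := GRing.Zmodule.on quotmod.

Local Notation pi := (\pi_(Quotient.quot (submod_pred hN))%qT : M -> quotmod).

Let scale a (x : quotmod) : quotmod := pi (a *: repr x).

Let piP (x y : M) : pi x = pi y <-> x - y \in N.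
Proof.
rewrite (_ : (x - y \in N) = (x - y \in submod_pred hN))//.
rewrite Quotient.idealrBE; split => [-> // | /eqP //].
Qed.

Let pi_scale a x : pi (a *: x) = scale a (pi x).
Proof.
apply/piP; rewrite -scalerBr.
apply: (rpredZ a : forall u, u \in submod_pred hN -> _).
by apply/piP; rewrite reprK.
Qed.

Let piD x y : pi (x + y) = pi x + pi y.
Proof. by rewrite Quotient.pi_add. Qed.

Let piK (x : quotmod) : pi (repr x) = x. Proof. exact: reprK. Qed.

Fact quotmod_scaleA a b x : scale a (scale b x) = scale (a * b) x.
Proof. by rewrite -[x]piK -!pi_scale scalerA. Qed.

Fact quotmod_scale1 : left_id 1 scale.
Proof. by move=> x; rewrite -[x]piK -pi_scale scale1r. Qed.

Fact quotmod_scaleDr : right_distributive scale +%R.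
Proof.
move=> a x y; rewrite -[x]piK -[y]piK.
by rewrite -[LHS]/(scale a (pi _ + pi _)) -piD -!pi_scale scalerDr piD.
Qed.

Fact quotmod_scaleDl x : {morph scale^~ x : a b / a + b}.
Proof. by move=> a b; rewrite -[x]piK -!pi_scale scalerDl piD. Qed.

HB.instance Definition _ := GRing.Zmodule_isLmodule.Build A quotmod
  quotmod_scaleA quotmod_scale1 quotmod_scaleDr quotmod_scaleDl.

Fact quotmod_pi_linear : linear (pi : M -> quotmod).
Proof. by move=> a x y; rewrite piD pi_scale. Qed.

Definition quotmod_pi := linear_of quotmod_pi_linear.

Lemma quotmod_pi_surj (y : quotmod) : exists x, quotmod_pi x = y.
Proof. by exists (repr y); rewrite /= reprK. Qed.

Lemma quotmod_pi_ker x : quotmod_pi x = 0 <-> x \in N.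
Proof. by rewrite -(linear0 quotmod_pi) -[x in X in _ <-> X]subr0; apply: piP. Qed.

End QuotientModule.

(** A set-theoretic section of p, composed with g, is linear because g does not
    see the kernel of p. *)
Lemma factor_surj (A : pzRingType) (M X Y : lmodType A)
    (p : {linear M -> X}) (g : {linear M -> Y}) :
  (forall x, exists m, p m = x) -> (forall m, p m = 0 -> g m = 0) ->
  exists h : {linear X -> Y}, forall m, h (p m) = g m.
Proof.
move=> /choice[s sK] kerg.
have gs m : g (s (p m)) = g m.
  by apply/eqP; rewrite -subr_eq0 -linearB kerg// linearB sK subrr.
have h_lin : linear (g \o s).
  move=> a x y; rewrite /= -linearP -[RHS]gs.
  by rewrite [p (_ + _)]linearP !sK.
by exists (linear_of h_lin).
Qed.

(** * Retracts and the layers of a module *)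

Definition retract (A : pzRingType) (N M : lmodType A) : Prop :=
  exists (i : {linear N -> M}) (p : {linear M -> N}), forall x, p (i x) = x.

Section Retracts.
Context (A : pzRingType).
Implicit Types M N X : lmodType A.

Lemma retract_refl M : retract M M.
Proof. by exists idfun, idfun. Qed.

Lemma retract_trans M N X : retract X N -> retract N M -> retract X M.
Proof.
by move=> [i [p pi]] [j [q qj]]; exists (j \o i), (p \o q) => x /=; rewrite qj pi.
Qed.

Lemma linear_pair M N X (f : {linear X -> M}) (g : {linear X -> N}) :
  exists h : {linear X -> (M * N)%type}, forall x, h x = (f x, g x).
Proof.
have h_lin : linear (fun x => (f x, g x)) by move=> a x y; rewrite !linearP.
by exists (linear_of h_lin).
Qed.

Lemma linear_copair M N X (f : {linear M -> X}) (g : {linear N -> X}) :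
  exists h : {linear (M * N)%type -> X}, forall x, h x = f x.1 + g x.2.
Proof.
exists ((f \o fst) \+ (g \o snd) : {linear _ -> _}) => x //.
Qed.

Lemma retract_prod M M' N N' :
  retract M M' -> retract N N' -> retract (M * N)%type (M' * N')%type.
Proof.
move=> [i [p pi]] [j [q qj]].
have [h hE] := linear_pair (i \o fst : {linear (M * N)%type -> _}) (j \o snd).
have [k kE] := linear_pair (p \o fst : {linear (M' * N')%type -> _}) (q \o snd).
by exists h, k => -[x y]; rewrite kE hE /= pi qj.
Qed.

Lemma retract_fst M N : retract M (M * N)%type.
Proof.
have [h hE] := linear_pair (idfun : {linear M -> M}) (\0 : {linear M -> N}).
by exists h, fst => x; rewrite hE.
Qed.

Lemma retract_snd M N : retract N (M * N)%type.
Proof.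
have [h hE] := linear_pair (\0 : {linear N -> M}) (idfun : {linear N -> N}).
by exists h, snd => x; rewrite hE.
Qed.

Lemma retract0 M N : (forall x : M, x = 0) -> retract M N.
Proof. by move=> M0; exists \0, \0 => x; rewrite [RHS]M0. Qed.

(** A complement of a retract is the kernel of the retraction. *)
Lemma summandP N M : summand N M <-> retract N M.
Proof.
split=> [[L [h h_bij]]|[i [p pi]]].
  have [g hK gK] := h_bij.
  have g_lin : linear g.
    by move=> a x y; apply: (can_inj hK); rewrite gK linearP !gK.
  have [j [q jq]] := retract_fst N L.
  by exists (linear_of g_lin \o j), (q \o h) => x /=; rewrite gK jq.
have hL : submodule (ker_of p predT) by exact: ker_of_submodule.
have kerE (x : M) : ((idfun \- (i \o p)) : {linear M -> M}) x \in ker_of p predT.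
  by apply/ker_ofP; rewrite /= linearB /= pi subrr.
have [r rE] := lift_submod hL kerE.
have [h hE] := linear_pair p r.
have [g gE] := linear_copair i (submod_val hL).
exists (submod hL), h, g => x.
  by rewrite gE hE rE /= subrKC.
have px : p (submod_val hL x.2) = 0 by have /ker_ofP[] := submod_valP x.2.
have pgx : p (g x) = x.1 by rewrite gE linearD px addr0 pi.
rewrite hE pgx; apply: injective_projections => //=.
by apply: submod_val_inj; rewrite rE /= pgx gE addrC addKr.
Qed.

Lemma retract_pow n M : retract {ffun 'I_n.+1 -> M} ({ffun 'I_n -> M} * M)%type.
Proof.
have u_lin : linear (fun m : {ffun 'I_n.+1 -> M} =>
    ([ffun i => m (lift ord_max i)] : {ffun 'I_n -> M}, m ord_max)).
  move=> a x y; rewrite !ffunE; congr pair.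
  by apply/ffunP => i; rewrite !ffunE.
have v_lin : linear (fun m : {ffun 'I_n -> M} * M =>
    [ffun i => if unlift ord_max i is Some j then m.1 j else m.2] :
      {ffun 'I_n.+1 -> M}).
  by move=> a x y; apply/ffunP => i; rewrite !ffunE; case: unliftP => [j|] _;
    rewrite /= ?ffunE.
exists (linear_of u_lin), (linear_of v_lin) => m.
by apply/ffunP => i; rewrite /= !ffunE; case: unliftP => [j|] -> //; rewrite ffunE.
Qed.

Lemma retract_dsum (V W : nat -> fgmod A) n :
  (forall i, (i < n)%N -> retract (V i) (W i)) -> retract (dsum V n) (dsum W n).
Proof.
elim: n => [|n IHn] VW; first exact: retract_refl.
by apply: retract_prod; [apply: IHn => i /ltnW; exact: VW | exact: VW].
Qed.

Lemma retract_pow_dsum n (T : fgmod A) :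
  retract {ffun 'I_n -> T} (dsum (fun=> T) n).
Proof.
elim: n => [|n IHn]; first by apply: retract0 => x; apply/ffunP => -[].
apply: retract_trans (retract_pow _ _) _.
by apply: retract_prod => //; exact: retract_refl.
Qed.

End Retracts.

(** The closure properties of the layers: under retracts, under replacing the
    generator by a module of which it is a retract, and under extensions. *)
Section Layers.
Context (A : pzRingType).
Implicit Types (S T M N : fgmod A) (U V : fgmod A -> Prop).

Lemma add_retract U M N : retract N M -> add U M -> add U N.
Proof.
move=> NM [n [V [UV MV]]]; exists n, V; split=> //.
by apply/summandP; apply: retract_trans NM _; apply/summandP.
Qed.

Lemma sub_add U M : U M -> add U M.
Proof.
move=> UM; exists 1%N, (fun=> M); split=> //.
by apply/summandP; exact: retract_snd.
Qed.

Lemma add_mono U V M : (forall N, U N -> V N) -> add U M -> add V M.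
Proof. by move=> UV [n [W [UW MW]]]; exists n, W; split=> // i /UW/UV. Qed.

Lemma add_pow T M n : retract M {ffun 'I_n -> T} -> add (fun N => N = T) M.
Proof.
move=> MT; exists n, (fun=> T); split=> //; apply/summandP.
exact: retract_trans MT (retract_pow_dsum _ _).
Qed.

Lemma add_mono_retract S T M :
  retract S T -> add (fun N => N = S) M -> add (fun N => N = T) M.
Proof.
move=> ST [n [V [VS MV]]]; exists n, (fun=> T); split=> //.
apply/summandP; apply: retract_trans (_ : retract _ (dsum V n)) _.
  exact/summandP.
by apply: retract_dsum => i /VS ->.
Qed.

Lemma layer_retract T n M N : retract N M -> layer T n.+1 M -> layer T n.+1 N.
Proof. by case: n => [|n]; exact: add_retract. Qed.

Lemma layer_mono S T n M : retract S T -> layer S n.+1 M -> layer T n.+1 M.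
Proof.
move=> ST; elim: n M => [|n IHn] M; first exact: add_mono_retract.
apply: add_mono => N [M1 [M2 [u [v [M1S M2S uv]]]]].
by exists M1, M2, u, v; split=> //; [exact: add_mono_retract M1S | exact: IHn].
Qed.

Lemma layer_extension T n (M1 M M2 : fgmod A)
    (u : {linear M1 -> M}) (v : {linear M -> M2}) :
  add (fun N => N = T) M1 -> layer T n.+1 M2 -> short_exact u v ->
  layer T n.+2 M.
Proof. by move=> *; apply: sub_add; exists M1, M2, u, v. Qed.

End Layers.

(** * Exact functors *)

(** Linear maps carry a proof of linearity, so functoriality and additivity are
    stated up to pointwise equality of the maps. *)
Record exact_functor (A B : pzRingType) := ExactFunctor {
  fobj :> lmodType A -> lmodType B;
  fmap : forall (M N : lmodType A), {linear M -> N} -> {linear fobj M -> fobj N};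
  fmap_id : forall (M : lmodType A) (f : {linear M -> M}), f =1 id -> fmap f =1 id;
  fmap_comp : forall (M N X : lmodType A) (f : {linear M -> N})
    (g : {linear N -> X}) (h : {linear M -> X}), h =1 g \o f -> fmap h =1 fmap g \o fmap f;
  fmapD : forall (M N : lmodType A) (f g h : {linear M -> N}),
    h =1 f \+ g -> fmap h =1 fmap f \+ fmap g;
  fmap_exact : forall (M1 M M2 : lmodType A) (u : {linear M1 -> M})
    (v : {linear M -> M2}),
    short_exact u v -> short_exact (fmap u) (fmap v);
  fobj_fg : forall M : lmodType A, finitely_generated M -> finitely_generated (fobj M)
}.

Arguments fmap_id {A B} _ [M f].
Arguments fmap_comp {A B} _ [M N X f g] h.
Arguments fmapD {A B} _ [M N f g] h.

Lemma kernel_image_exact (A : pzRingType) (M X : lmodType A)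
    (u : {linear M -> X}) (hK : submodule (ker_of u predT))
    (hI : submodule (image_of u predT)) :
  exists v : {linear M -> submod hI}, short_exact (submod_val hK) v.
Proof.
have [v vE] : exists v : {linear M -> submod hI},
    forall x, submod_val hI (v x) = u x.
  by apply: lift_submod => x; apply/image_ofP; exists x.
exists v; split; first exact: submod_val_inj.
- move=> x; split=> [vx|[y <-]].
    apply: submod_valK; apply/ker_ofP; split=> //.
    by rewrite -vE vx linear0.
  apply: (@submod_val_inj _ _ _ hI); rewrite vE linear0.
  by have /ker_ofP[] := submod_valP y.
- move=> z; have /image_ofP[x _ xz] := submod_valP z.
  by exists x; apply: (@submod_val_inj _ _ _ hI); rewrite vE.
Qed.

(** The pullback of the inclusion of I and of a surjection P -> H is an
    extension of H by the preimage K of I that splits as I + P: the map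
    (x, y) |-> x + s y is onto H, and its kernel is K embedded by
    y |-> (- s y, y). *)
Lemma preimage_exact (A : pzRingType) (H P : lmodType A) (I : {pred H})
    (hI : submodule I) (s : {linear P -> H}) (hK : submodule (preim_of s I)) :
  (forall z, exists y, s y = z) ->
  exists (i : {linear submod hK -> (submod hI * P)%type})
    (p : {linear (submod hI * P)%type -> H}), short_exact i p.
Proof.
move=> s_surj.
have n_lin : linear (fun y : submod hK => - s (submod_val hK y)).
  by move=> a x y; rewrite [submod_val _ _]linearP [s _]linearP opprD scalerN.
have nI (y : submod hK) : linear_of n_lin y \in I.
  have /preim_ofP/(submoduleZ hI (-1)) := submod_valP y.
  by rewrite scaleN1r.
have [w wE] := lift_submod hI nI.
have [i iE] := linear_pair w (submod_val hK).
have [p pE] := linear_copair (submod_val hI) s.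
exists i, p; split.
- by move=> y z; rewrite !iE => -[_ /submod_val_inj].
- move=> [y z]; split=> [|[t <-]]; last by rewrite iE pE wE /= addNr.
  rewrite pE /= => /eqP; rewrite addr_eq0 => /eqP yz.
  have [t tz] : exists t : submod hK, submod_val hK t = z.
    apply: submod_valK; apply/preim_ofP; rewrite -[s z]opprK -yz -scaleN1r.
    by apply: submoduleZ => //; exact: submod_valP.
  exists t; rewrite iE tz; congr pair.
  apply: (@submod_val_inj _ _ _ hI); transitivity (- s z); last exact: esym yz.
  by rewrite -tz; exact: wE.
- move=> z; have [y <-] := s_surj z; exists (0, y).
  by rewrite pE linear0 add0r.
Qed.

Section FunctorLayers.
Context (A B : pzRingType) (F : exact_functor A B).

Definition fgmap (M : fgmod A) : fgmod B := FGMod (fobj_fg F (fgmodP M)).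

Lemma functor_retract (N M : lmodType A) : retract N M -> retract (F N) (F M).
Proof.
move=> [i [p pi]]; exists (fmap F i), (fmap F p) => x.
by rewrite -[LHS](fmap_comp F (p \o i))//; exact: fmap_id.
Qed.

Lemma functor_zero (M : lmodType A) (x : F M) : (forall y : M, y = 0) -> x = 0.
Proof.
move=> M0; have e : fmap F (idfun : {linear M -> M}) =1 id by exact: fmap_id.
rewrite -[LHS]e; apply: (@addrI _ (fmap F (idfun : {linear M -> M}) x)).
by rewrite addr0 -[LHS](fmapD F idfun) // => y; rewrite /= [LHS]M0 [RHS]M0.
Qed.

(** An additive functor preserves the identity
    1 = i1 p1 + i2 p2 of a product. *)
Lemma functor_prod (M N : lmodType A) :
  retract (F (M * N)%type) (F M * F N)%type.
Proof.
have [i iE] := linear_pair (idfun : {linear M -> M}) (\0 : {linear M -> N}).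
have [j jE] := linear_pair (\0 : {linear N -> M}) (idfun : {linear N -> N}).
have [h hE] := linear_pair (fmap F (fst : {linear (M * N)%type -> M}))
  (fmap F (snd : {linear (M * N)%type -> N})).
have [k kE] := linear_copair (fmap F i) (fmap F j).
exists h, k => x; rewrite kE hE /=.
have e1 := fmap_comp F (i \o fst) (f := fst) (g := i) (fun=> erefl) x.
have e2 := fmap_comp F (j \o snd) (f := snd) (g := j) (fun=> erefl) x.
rewrite -[fmap F i _]e1 -[fmap F j _]e2.
rewrite -[LHS](fmapD F idfun (f := i \o fst) (g := j \o snd)).
  exact: fmap_id.
by move=> [y z]; rewrite /= iE jE; congr pair; rewrite /= ?addr0 ?add0r.
Qed.

Lemma functor_dsum (V : nat -> fgmod A) n :
  retract (F (dsum V n)) (dsum (fgmap \o V) n).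
Proof.
elim: n => [|n IHn].
  by apply: retract0 => x; apply: functor_zero => y; apply/matrixP => ? [].
apply: retract_trans (functor_prod _ _) _.
by apply: retract_prod => //; exact: retract_refl.
Qed.

Lemma functor_add (U : fgmod A -> Prop) (U' : fgmod B -> Prop) M :
  (forall N, U N -> U' (fgmap N)) -> add U M -> add U' (fgmap M).
Proof.
move=> UU' [n [V [UV MV]]]; exists n, (fgmap \o V); split.
  by move=> i /UV/UU'.
apply/summandP; apply: retract_trans (_ : retract _ (F (dsum V n))) _.
  exact/functor_retract/summandP.
exact: functor_dsum.
Qed.

Lemma functor_layer T n M : layer T n.+1 M -> layer (fgmap T) n.+1 (fgmap M).
Proof.
elim: n M => [|n IHn] M; first by apply: functor_add => N ->.
apply: functor_add => N [M1 [M2 [u [v [M1T M2T uv]]]]].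
exists (fgmap M1), (fgmap M2), (fmap F u), (fmap F v); split.
- by apply: functor_add M1T => X ->.
- exact: IHn.
- exact: fmap_exact.
Qed.

End FunctorLayers.

(** If no layer exhausts the modules over B, the bound is +oo. *)
Lemma extension_dim_le (A B : pzRingType) k :
  (forall n, generated_in B n -> generated_in A (n + k)) ->
  (extension_dim A <= extension_dim B + k%:Z%:E)%E.
Proof.
move=> AB; rewrite /extension_dim.
case: (pselect (exists n, generated_in B n)) => [exB|_]; last first.
  by rewrite addye// leey.
case: pselect => [exA|[]]; last by have [n /AB] := exB; exists (n + k)%N.
case: ex_minnP => a _ a_min; case: ex_minnP => b /asboolP Bb _.
by rewrite -EFinD lee_fin -PoszD lez_nat a_min//; exact/asboolP/AB.
Qed.

(** * Chain conditions *)

Section ChainConditions.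
Context (A : pzRingType).
Implicit Types M X Y : lmodType A.

Definition fg_submodule M (N : {pred M}) : Prop :=
  exists (n : nat) (g : 'I_n -> M), (forall i, g i \in N) /\
    forall x, x \in N -> exists c : 'I_n -> A, x = \sum_i c i *: g i.

Definition noetherian_module M : Prop :=
  forall N : {pred M}, submodule N -> fg_submodule N.

Definition artinian_module M : Prop :=
  forall I : nat -> {pred M},
    (forall n, submodule (I n)) -> (forall n, {subset I n.+1 <= I n}) ->
    exists n, forall m, (n <= m)%N -> I m =i I n.

(** The descending chain condition as a minimum principle, by dependent
    choice. *)
Lemma artinian_min M (P : {pred M} -> Prop) :
  artinian_module M -> (exists N, submodule N /\ P N) ->
  exists N, [/\ submodule N, P N &
    forall N', submodule N' -> P N' -> {subset N' <= N} -> {subset N <= N'}].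
Proof.
move=> artM [N0 [hN0 PN0]]; apply: contrapT => nomin.
pose T := {N : {pred M} | submodule N /\ P N}.
have next (N : T) : exists N' : T,
    {subset sval N' <= sval N} /\ ~ {subset sval N <= sval N'}.
  apply: contrapT => noN'; apply: nomin; exists (sval N).
  case: N noN' => N [hN PN] /= noN'; split=> // N' hN' PN' N'N.
  by apply: contrapT => NN'; apply: noN'; exists (exist _ N' (conj hN' PN')).
have [s sP] := choice next.
pose t n := iter n s (exist _ N0 (conj hN0 PN0)).
have [n tn] := artM (fun n => sval (t n)) (fun n => (svalP (t n)).1)
  (fun n => (sP (t n)).1).
by case: (sP (t n)) => _; apply=> x; rewrite -(tn n.+1).
Qed.

Lemma fg_submodule_image M X (u : {linear M -> X}) (N : {pred M}) :
  fg_submodule N -> fg_submodule (image_of u N).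
Proof.
move=> [n [g [Ng gN]]]; exists n, (u \o g); split=> [i|_ /image_ofP[x /gN[c ->] <-]].
  by apply/image_ofP; exists (g i).
by exists c; rewrite linear_sum; apply: eq_bigr => i _; rewrite linearZ.
Qed.

Lemma fg_submodule_ext M X (u : {linear M -> X}) (N : {pred M}) :
  submodule N ->
  fg_submodule (ker_of u N) ->
  fg_submodule (image_of u N) ->
  fg_submodule N.
Proof.
move=> hN [n [g [gN gP]]] [m [h [hh hP]]].
have /choice[k kP] i : exists x, x \in N /\ u x = h i.
  by have /image_ofP[x Nx <-] := hh i; exists x.
exists (n + m)%N, (fun i : 'I_(n + m) =>
  match fintype.split i with inl j => g j | inr j => k j end).
split=> [i|x Nx].
  by case: fintype.split => j; [have /ker_ofP[] := gN j | have [] := kP j].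
have [d dE] : exists d : 'I_m -> A, u x = \sum_i d i *: h i.
  by apply: hP; apply/image_ofP; exists x.
pose y := \sum_i d i *: k i.
have Ny : y \in N by apply: submodule_sum => // i; case: (kP i).
have [c cE] : exists c : 'I_n -> A, x - y = \sum_i c i *: g i.
  apply: gP; apply/ker_ofP; split; first exact: submoduleB.
  rewrite linearB dE linear_sum; apply/eqP; rewrite subr_eq0; apply/eqP.
  by apply: eq_bigr => i _; rewrite linearZ; case: (kP i) => _ ->.
exists (fun i : 'I_(n + m) =>
  match fintype.split i with inl j => c j | inr j => d j end).
rewrite big_split_ord /=.
under eq_bigr do rewrite (unsplitK (inl _)).
under [X in _ = _ + X]eq_bigr do rewrite (unsplitK (inr _)).
by rewrite -cE subrK.
Qed.

(** Only exactness at M is required, so Y = 0 gives the case of submodules and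
    X = 0 that of quotients. *)
Lemma noetherian_ext M X (u : {linear M -> X}) Y (v : {linear Y -> M}) :
  (forall x, u x = 0 -> exists y, v y = x) ->
  noetherian_module Y -> noetherian_module X -> noetherian_module M.
Proof.
move=> uv noY noX N hN; apply: (fg_submodule_ext (u := u)) => //; last first.
  exact/noX/image_submodule.
have := fg_submodule_image v (noY _ (preim_submodule v (ker_of_submodule u hN))).
congr fg_submodule; apply/funext => x; apply: asbool_equiv_eq; split.
  by move=> [y /preim_ofP/ker_ofP Nvy <-].
move=> [Nx /[dup] ux /uv[y vy]]; exists y => //; apply/preim_ofP/ker_ofP.
by rewrite vy.
Qed.

Lemma artinian_ext M X (u : {linear M -> X}) Y (v : {linear Y -> M}) :
  (forall x, u x = 0 -> exists y, v y = x) ->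
  artinian_module Y -> artinian_module X -> artinian_module M.
Proof.
move=> uv artY artX I hI decI.
have leI n m : (n <= m)%N -> {subset I m <= I n}.
  elim: m => [|m IHm]; first by rewrite leqn0 => /eqP->.
  by rewrite leq_eqVlt => /predU1P[-> //|/IHm mn x /decI/mn].
have [||n1 n1P] := artY (fun n => preim_of v (I n)).
- by move=> n; exact: preim_submodule.
- by move=> n y /preim_ofP Iy; apply/preim_ofP/decI.
have [||n2 n2P] := artX (fun n => image_of u (I n)).
- by move=> n; exact: image_submodule.
- by move=> n _ /image_ofP[x Ix <-]; apply/image_ofP; exists x => //; exact: decI.
exists (n1 + n2)%N => m nm x.
apply/idP/idP => [|Ix]; first exact: leI.
have : u x \in image_of u (I n2).
  by apply/image_ofP; exists x => //; apply: leI Ix; exact: leq_addl.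
rewrite -(n2P m); last exact: leq_trans (leq_addl _ _) nm.
move=> /image_ofP[y Iy uyx].
have [z vz] : exists z, v z = x - y.
  by apply: uv; rewrite linearB uyx subrr.
have : z \in preim_of v (I n1).
  apply/preim_ofP; rewrite vz; apply: submoduleB => //.
    by apply: leI Ix; exact: leq_addr.
  by apply: leI Iy; exact: leq_trans (leq_addr _ _) nm.
rewrite -(n1P m); last exact: leq_trans (leq_addr _ _) nm.
by move=> /preim_ofP; rewrite vz => Ixy; rewrite -[x](subrK y); exact: submoduleD.
Qed.

Lemma noetherian0 X : (forall x : X, x = 0) -> noetherian_module X.
Proof.
by move=> X0 N hN; exists 0%N, (fun=> 0); split=> [[]//|x _]; exists (fun=> 0);
  rewrite big_ord0.
Qed.

Lemma artinian0 X : (forall x : X, x = 0) -> artinian_module X.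
Proof.
by move=> X0 I hI _; exists 0%N => m _ x; rewrite (X0 x) !submodule0.
Qed.

Lemma noetherian_inj M Y (u : {linear M -> Y}) :
  injective u -> noetherian_module Y -> noetherian_module M.
Proof.
move=> uI noY; apply: (noetherian_ext (u := u) (v := (\0 : {linear 'rV[A]_0 -> M}))).
- by move=> x ux; exists 0; apply: uI; rewrite ux /= linear0.
- by apply: noetherian0 => x; apply/matrixP => ? [].
- exact: noY.
Qed.

Lemma artinian_inj M Y (u : {linear M -> Y}) :
  injective u -> artinian_module Y -> artinian_module M.
Proof.
move=> uI noY; apply: (artinian_ext (u := u) (v := (\0 : {linear 'rV[A]_0 -> M}))).
- by move=> x ux; exists 0; apply: uI; rewrite ux /= linear0.
- by apply: artinian0 => x; apply/matrixP => ? [].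
- exact: noY.
Qed.

Lemma noetherian_surj M Y (u : {linear Y -> M}) :
  (forall x, exists y, u y = x) -> noetherian_module Y -> noetherian_module M.
Proof.
move=> us noY.
apply: (noetherian_ext (u := (\0 : {linear M -> 'rV[A]_0})) (v := u)) => //.
by apply: noetherian0 => x; apply/matrixP => ? [].
Qed.

Lemma artinian_surj M Y (u : {linear Y -> M}) :
  (forall x, exists y, u y = x) -> artinian_module Y -> artinian_module M.
Proof.
move=> us noY.
apply: (artinian_ext (u := (\0 : {linear M -> 'rV[A]_0})) (v := u)) => //.
by apply: artinian0 => x; apply/matrixP => ? [].
Qed.

Lemma noetherian_prod M X :
  noetherian_module M -> noetherian_module X -> noetherian_module (M * X)%type.
Proof.
have [h hE] := linear_pair (idfun : {linear M -> M}) (\0 : {linear M -> X}).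
apply: (@noetherian_ext _ _ snd _ h) => -[x y] /= ->; exists x; exact: hE.
Qed.

Lemma artinian_prod M X :
  artinian_module M -> artinian_module X -> artinian_module (M * X)%type.
Proof.
have [h hE] := linear_pair (idfun : {linear M -> M}) (\0 : {linear M -> X}).
apply: (@artinian_ext _ _ snd _ h) => -[x y] /= ->; exists x; exact: hE.
Qed.

Lemma noetherian_pow M n :
  noetherian_module M -> noetherian_module {ffun 'I_n -> M}.
Proof.
move=> noM; elim: n => [|n IHn].
  by apply: noetherian0 => x; apply/ffunP => -[].
have [i [p /can_inj iI]] := retract_pow n M.
exact: noetherian_inj iI (noetherian_prod IHn noM).
Qed.

Lemma artinian_pow M n :
  artinian_module M -> artinian_module {ffun 'I_n -> M}.
Proof.
move=> noM; elim: n => [|n IHn].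
  by apply: artinian0 => x; apply/ffunP => -[].
have [i [p /can_inj iI]] := retract_pow n M.
exact: artinian_inj iI (artinian_prod IHn noM).
Qed.

Lemma linear_comb M n (g : 'I_n -> M) :
  exists h : {linear {ffun 'I_n -> A^o} -> M}, forall c, h c = \sum_i (c i : A) *: g i.
Proof.
have h_lin : linear (fun c : {ffun 'I_n -> A^o} => \sum_i (c i : A) *: g i).
  move=> a c d; rewrite scaler_sumr -big_split /=; apply: eq_bigr => i _.
  by rewrite !ffunE scalerDl scalerA.
by exists (linear_of h_lin).
Qed.

Lemma fg_surj M : finitely_generated M ->
  exists n (h : {linear {ffun 'I_n -> A^o} -> M}), forall x, exists c, h c = x.
Proof.
move=> [n [g gP]]; have [h hE] := linear_comb g; exists n, h => x.
have [c ->] := gP x; exists (finfun c); rewrite hE.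
by apply: eq_bigr => i _; rewrite ffunE.
Qed.

Lemma fg_image M X (u : {linear M -> X}) :
  (forall x, exists y, u y = x) -> finitely_generated M -> finitely_generated X.
Proof.
move=> us [n [g gP]]; exists n, (u \o g) => x; have [y <-] := us x.
have [c ->] := gP y; exists c; rewrite linear_sum.
by apply: eq_bigr => i _; rewrite linearZ.
Qed.

Lemma noetherian_fg M : noetherian_module M -> finitely_generated M.
Proof.
move=> /(_ predT)[//|n [g [_ gP]]]; exists n, g => x; exact: gP.
Qed.

Lemma fg_noetherian M :
  noetherian_module A^o -> finitely_generated M -> noetherian_module M.
Proof. by move=> noA /fg_surj[n [h /noetherian_surj]]; apply; exact: noetherian_pow. Qed.

Lemma fg_artinian M :
  artinian_module A^o -> finitely_generated M -> artinian_module M.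
Proof. by move=> noA /fg_surj[n [h /artinian_surj]]; apply; exact: artinian_pow. Qed.

Lemma fg_prod M X :
  finitely_generated M -> finitely_generated X -> finitely_generated (M * X)%type.
Proof.
move=> [n [g gP]] [m [h hP]].
have [u uE] := linear_pair (idfun : {linear M -> M}) (\0 : {linear M -> X}).
have [v vE] := linear_pair (\0 : {linear X -> M}) (idfun : {linear X -> X}).
exists (n + m)%N, (fun i : 'I_(n + m) =>
  match fintype.split i with inl j => u (g j) | inr j => v (h j) end).
move=> [x y]; have [c xE] := gP x; have [d yE] := hP y.
exists (fun i : 'I_(n + m) =>
  match fintype.split i with inl j => c j | inr j => d j end).
rewrite big_split_ord /=.
under eq_bigr do rewrite (unsplitK (inl _)) -linearZ.
under [X in _ = _ + X]eq_bigr do rewrite (unsplitK (inr _)) -linearZ.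
rewrite -!linear_sum -xE -yE uE vE.
by congr pair; rewrite /= ?addr0 ?add0r.
Qed.

Lemma fg_submod M (N : {pred M}) (hN : submodule N) :
  noetherian_module M -> finitely_generated (submod hN).
Proof.
move=> noM; apply: noetherian_fg.
exact: noetherian_inj (@submod_val_inj _ _ _ hN) noM.
Qed.

Lemma fg_free1 : finitely_generated A^o.
Proof. by exists 1%N, (fun=> 1) => x; exists (fun=> x); rewrite big_ord1 [RHS]mulr1. Qed.

End ChainConditions.

(** * Artinian commutative rings are noetherian *)

Section Hopkins.
Context (R : comNzRingType).

Let scaling (r : R) : {linear R^o -> R^o}.
Proof.
apply: (@linear_of R R^o R^o (fun x => r *: x)) => a x y.
by rewrite scalerDr !scalerA mulrC.
Defined.

(** Both r I and the kernel of r on I are submodules of I; if both were proper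
    they would be finitely generated by minimality, and then so would I. *)
Lemma minimal_nonfg_scaling (I : {pred R^o}) (r : R) :
  submodule I -> ~ fg_submodule I ->
  (forall N, submodule N -> ~ fg_submodule N -> {subset N <= I} -> {subset I <= N}) ->
  (forall x, x \in I -> r *: x = 0) \/
  (forall x, x \in I -> exists2 y, y \in I & r *: y = x).
Proof.
move=> hI nfgI minI.
have [fgim|nfg] := pselect (fg_submodule (image_of (scaling r) I)); last first.
  right => x Ix; apply/image_ofP/(minI _ _ nfg) => //; first exact: image_submodule.
  by move=> _ /image_ofP[y Iy <-]; exact: submoduleZ.
left=> x Ix.
have nfgker : ~ fg_submodule (ker_of (scaling r) I).
  by move=> fgker; apply: nfgI; exact: fg_submodule_ext fgim.
suff /ker_ofP[] : x \in ker_of (scaling r) I by [].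
apply: (minI _ _ nfgker) => //; first exact: ker_of_submodule.
by move=> y /ker_ofP[].
Qed.

Lemma artinian_power (r : R) :
  artinian R -> exists n s, r ^+ n = r ^+ n.+1 * s.
Proof.
move=> artR; have [||n] := artR (fun n => image_of (scaling (r ^+ n)) predT).
- by move=> n; apply: image_submodule; split.
- move=> n _ /image_ofP[x _ <-]; apply/image_ofP; exists (r *: x) => //=.
  by rewrite scalerA -exprSr.
move=> /(_ n.+1 (leqnSn n) (r ^+ n)) e.
have /image_ofP[s _ sE] : r ^+ n \in image_of (scaling (r ^+ n.+1)) predT.
  by rewrite e; apply/image_ofP; exists 1; rewrite //= [LHS]mulr1.
by exists n, s; rewrite -[LHS]sE.
Qed.

(** A minimal ideal I that is not finitely generated would be a vector space over
    a field: each r kills I or is onto I, and in the latter case a power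
    r^n = r^(n+1) s exhibits s as an inverse of r on I.  A hyperplane L of I is a
    proper submodule, so it is finitely generated, and adding one vector
    generates I. *)
Lemma hopkins : artinian R -> noetherian_module R^o.
Proof.
move=> artR; apply: contrapT => /existsNP[N0 /not_implyP[hN0 nfgN0]].
have [|I [hI nfgI minI]] := @artinian_min R R^o (fun N => ~ fg_submodule N) artR.
  by exists N0.
have scal r : (forall x, x \in I -> r *: x = 0) \/
    exists s, forall x, x \in I -> s *: (r *: x) = x.
  have [|rI] := minimal_nonfg_scaling r hI nfgI minI; first by left.
  right; have [n [s rns]] := artinian_power r artR; exists s => x Ix.
  have [y Iy <-] : exists2 y, y \in I & r ^+ n *: y = x.
    elim: n {rns} x Ix => [|n IHn] x Ix; first by exists x; rewrite ?expr0 ?scale1r.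
    have [y Iy <-] := rI x Ix; have [z Iz <-] := IHn y Iy.
    by exists z; rewrite // exprS scalerA.
  by rewrite !scalerA [in RHS]rns exprS -[in LHS]mulrA [in LHS]mulrC.
have [x0 Ix0 x0N0] : exists2 x : R^o, x \in I & x <> 0.
  apply: contrapT => noI; apply: nfgI; exists 0%N, (fun=> 0); split=> [[]//|x Ix].
  exists (fun=> 0); rewrite big_ord0; apply: contrapT => xN0.
  by apply: noI; exists x.
(* Closure under [a *: x + y] alone lets the empty union be a candidate; a
   maximal L is nonempty because {0} is a larger candidate than the empty set. *)
pose P (L : set R^o) := [/\ (forall x, L x -> x \in I), ~ L x0 &
  forall a x y, L x -> L y -> L (a *: x + y)].
have [L [[LI Lx0 LP] maxL]] : exists L, P L /\ forall B, (L `<` B)%classic -> ~ P B.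
  apply: Zorn_bigcup => F FP totF; split.
  - by move=> x [X /FP[XI _ _] Xx]; exact: XI.
  - by move=> [X /FP[_ ? _]].
  - move=> a x y [X FX Xx] [Y FY Yy].
    have [XY|YX] := totF _ _ FX FY.
      by exists Y => //; have [_ _] := FP _ FY; apply=> //; exact: XY.
    by exists X => //; have [_ _] := FP _ FX; apply=> //; exact: YX.
have L0 : L 0.
  apply: contrapT => L0; apply: (maxL [set 0]%classic); last first.
    split=> [x ->|/x0N0|a x y -> ->] //; first exact: submodule0.
    by rewrite /= scaler0 addr0.
  split=> [x Lx|/(_ 0 erefl)//]; exfalso; apply: L0.
  by have := LP (-1) x x Lx Lx; rewrite scaleN1r addNr.
pose N := sep L.
have hN : submodule N.
  by split=> [|a x y /sepP Lx /sepP Ly]; apply/sepP => //; exact: LP.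
have fgN : fg_submodule N.
  apply: contrapT => nfgN.
  suff /sepP : x0 \in N by [].
  by apply: (minI N) => // x /sepP; exact: LI.
(* A maximal submodule of I missing x0 is a hyperplane: if y is not in L then
   x0 lies in L + R y, with an invertible coefficient at y. *)
have spanL y : y \in I -> exists a, y - a *: x0 \in N.
  move=> Iy; have [Ly|nLy] := pselect (L y).
    by exists 0; apply/sepP; rewrite scale0r subr0.
  pose B : set R^o := [set z | exists c, L (z - c *: y)]%classic.
  have LB : (L `<=` B)%classic by move=> z Lz; exists 0; rewrite scale0r subr0.
  have By : B y by exists 1; rewrite scale1r subrr.
  have Bx0 : B x0.
    apply: contrapT => nBx0; apply: (maxL B); first by split=> // /(_ y By).
    split=> //; first by move=> z [c /LI Iz]; rewrite -[z](subrK (c *: y));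
      apply: submoduleD => //; exact: submoduleZ.
    move=> a u v [c Lu] [d Lv]; exists (a * c + d).
    have -> : a *: u + v - (a * c + d) *: y = a *: (u - c *: y) + (v - d *: y).
      by rewrite scalerBr scalerDl scalerA opprD addrACA.
    exact: LP.
  have [c Lc] := Bx0.
  have [cI0|[s sc]] := scal c; first by rewrite cI0 // subr0 in Lc.
  exists s; apply/sepP; rewrite -[y in y - _](sc y Iy).
  have := LP (- s) _ _ Lc L0.
  by rewrite addr0 scaleNr scalerBr opprB.
have [n [g [gN gP]]] := fgN.
apply: nfgI; exists n.+1, (fun i => if unlift ord_max i is Some j then g j else x0).
split=> [i|y Iy].
  by case: unliftP => [j|] _ //; apply: LI; apply/sepP.
have [a /gP[c cE]] := spanL y Iy.
exists (fun i => if unlift ord_max i is Some j then c j else a).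
rewrite big_ord_recr /= unlift_none -[LHS](subrK (a *: x0)) cE; congr (_ + _).
apply: eq_bigr => i _.
have -> : widen_ord (leqnSn n) i = lift ord_max i.
  by apply: ord_inj; rewrite lift_max.
by rewrite liftK.
Qed.

End Hopkins.

(** * Restriction and induction of modules *)

Section Restriction.
Context (A B : pzRingType) (f : {rmorphism A -> B}).

Definition restr_linear (M N : lmodType B) (h : {linear M -> N}) :
  {linear (restr f M : lmodType A) -> (restr f N : lmodType A)}.
Proof.
apply: (@linear_of A (restr f M) (restr f N) h) => a x y.
exact: (linearP h (f a) x y).
Defined.

Lemma restr_submodule (M : lmodType B) (N : {pred M}) :
  submodule N -> submodule (N : {pred restr f M}).
Proof. by move=> [N0 hN]; split=> // a x y; exact: hN. Qed.

Lemma fg_of_restr (M : lmodType B) :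
  finitely_generated (restr f M) -> finitely_generated M.
Proof.
move=> [n [g gP]]; exists n, g => x; have [c ->] := gP x.
by exists (f \o c).
Qed.

Lemma noetherian_of_restr (M : lmodType B) :
  noetherian_module (restr f M) -> noetherian_module M.
Proof.
move=> noM N /restr_submodule/noM[n [g [Ng gP]]].
by exists n, g; split=> // x /gP[c ->]; exists (f \o c).
Qed.

Lemma artinian_of_restr (M : lmodType B) :
  artinian_module (restr f M) -> artinian_module M.
Proof. by move=> artM I hI; apply: artM => n; exact: restr_submodule. Qed.

Lemma fg_pow (M : lmodType A) n :
  finitely_generated M -> finitely_generated {ffun 'I_n -> M}.
Proof.
move=> fgM; elim: n => [|n IHn].
  exists 0%N, (fun=> 0) => x; exists (fun=> 0); rewrite big_ord0.
  by apply/ffunP => -[].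
have [i [p pi]] := retract_pow n M.
by apply: (fg_image (u := p)) (fg_prod IHn fgM) => x; exists (i x).
Qed.

Lemma restr_fg (M : lmodType B) :
  finitely_generated (restr f B^o) -> finitely_generated M ->
  finitely_generated (restr f M).
Proof.
move=> fgB [n [g gP]].
have h_lin : linear (fun c : {ffun 'I_n -> restr f B^o} =>
    (\sum_i (c i : B) *: g i : restr f M)).
  move=> a c d.
  transitivity (f a *: (\sum_i (c i : B) *: g i) + \sum_i (d i : B) *: g i) => //.
  rewrite scaler_sumr -big_split /=.
  by apply: eq_bigr => i _; rewrite !ffunE scalerDl scalerA.
apply: (fg_image (u := linear_of h_lin)) (fg_pow n fgB) => x.
have [c ->] := gP x; exists [ffun i => c i : restr f B^o].
by apply: eq_bigr => i _; rewrite ffunE.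
Qed.

Definition restriction (fgB : finitely_generated (restr f B^o)) :
  exact_functor B A.
Proof.
refine (@ExactFunctor B A (fun M => restr f M) restr_linear _ _ _ _ _) => //.
by move=> M fgM; exact: restr_fg.
Defined.

End Restriction.

(** A dual basis of B as a right A-module through f, the usual witness that B is
    finitely generated projective on that side. *)
Record dual_basis (A B : pzRingType) (f : {rmorphism A -> B}) (n : nat) :=
  DualBasis {
  dual_gen : 'I_n -> B;
  dual_coord : B -> 'I_n -> A;
  dual_coordD : forall x y i,
    dual_coord (x + y) i = dual_coord x i + dual_coord y i;
  dual_coordZ : forall x a i, dual_coord (x * f a) i = dual_coord x i * a;
  dual_sum : forall x, x = \sum_i dual_gen i * f (dual_coord x i)
}.

Section Induction.
Context (A B : pzRingType) (f : {rmorphism A -> B}) (n : nat) (db : dual_basis f n).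

Local Notation gam := (dual_gen db).
Local Notation phi := (dual_coord db).

Lemma dual_coord0 i : phi 0 i = 0.
Proof. by apply: (@addrI _ (phi 0 i)); rewrite -dual_coordD !addr0. Qed.

Lemma dual_coord_sum (I : finType) (x : I -> B) i :
  phi (\sum_k x k) i = \sum_k phi (x k) i.
Proof.
exact: (big_morph (fun x => phi x i) (fun x y => dual_coordD _ x y i) (dual_coord0 i)).
Qed.

(** The coordinates turn left multiplications of B into matrices over A; these
    multiply as they should except that 1 becomes an idempotent, which is the
    identity only when the generators form a basis. *)
Lemma dual_coordM b x i : phi (b * x) i = \sum_j phi (b * gam j) i * phi x j.
Proof.
rewrite {1}(dual_sum db x) mulr_sumr dual_coord_sum.
by apply: eq_bigr => j _; rewrite mulrA dual_coordZ.
Qed.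

Section Module.
Context (M : lmodType A).

(** The vector m stands for the tensor sum_i gam_i (x) m_i, and [ind_act b m] for
    b times that tensor. *)
Definition ind_act (b : B) (m : {ffun 'I_n -> M}) : {ffun 'I_n -> M} :=
  [ffun j => \sum_i phi (b * gam i) j *: m i].

Lemma ind_actM b c m : ind_act b (ind_act c m) = ind_act (b * c) m.
Proof.
apply/ffunP => k; rewrite !ffunE.
under eq_bigr do rewrite ffunE scaler_sumr.
rewrite exchange_big /=; apply: eq_bigr => i _.
rewrite -mulrA dual_coordM scaler_suml.
by apply: eq_bigr => j _; rewrite scalerA.
Qed.

Lemma ind_actDr b : {morph ind_act b : x y / x + y}.
Proof.
move=> x y; apply/ffunP => j; rewrite !ffunE -big_split.
by apply: eq_bigr => i _; rewrite ffunE scalerDr.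
Qed.

Lemma ind_actDl b c x : ind_act (b + c) x = ind_act b x + ind_act c x.
Proof.
apply/ffunP => j; rewrite !ffunE -big_split.
by apply: eq_bigr => i _; rewrite mulrDl dual_coordD scalerDl.
Qed.

(** B (x)_A M is the image of the idempotent [ind_act 1], that is, its set of
    fixed points. *)
Definition ind_pred : {pred {ffun 'I_n -> M}} := sep (fun m => ind_act 1 m = m).

Lemma ind_pred_zmod : zmod_closed ind_pred.
Proof.
have act0 : ind_act 1 0 = 0.
  by apply: (@addrI _ (ind_act 1 0)); rewrite -ind_actDr !addr0.
split=> [|x y /sepP xE /sepP yE]; first exact/sepP.
apply/sepP; rewrite -{2}xE -{2}yE; apply: (@addIr _ (ind_act 1 y)).
by rewrite -ind_actDr !subrK.
Qed.

HB.instance Definition _ := GRing.isZmodClosed.Build _ ind_pred ind_pred_zmod.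

Definition ind : Type := {m : {ffun 'I_n -> M} | ind_pred m}.
HB.instance Definition _ := SubType.on ind.
HB.instance Definition _ := Choice.on ind.
HB.instance Definition _ := [SubChoice_isSubZmodule of ind by <:].

Lemma ind_valP (m : ind) : ind_act 1 (val m) = val m.
Proof. by have /sepP := valP m. Qed.

Lemma ind_act_in b x : ind_act b x \in ind_pred.
Proof. by apply/sepP; rewrite ind_actM mul1r. Qed.

Definition ind_proj b x : ind := exist _ (ind_act b x) (ind_act_in b x).

Let scale b (m : ind) : ind := ind_proj b (val m).

Fact ind_scaleA a b x : scale a (scale b x) = scale (a * b) x.
Proof. by apply: val_inj; exact: ind_actM. Qed.

Fact ind_scale1 : left_id 1 scale.
Proof. by move=> x; apply: val_inj; exact: ind_valP. Qed.

Fact ind_scaleDr : right_distributive scale +%R.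
Proof. by move=> a x y; apply: val_inj; exact: ind_actDr. Qed.

Fact ind_scaleDl x : {morph scale^~ x : a b / a + b}.
Proof. by move=> a b; apply: val_inj; exact: ind_actDl. Qed.

HB.instance Definition _ := GRing.Zmodule_isLmodule.Build B ind
  ind_scaleA ind_scale1 ind_scaleDr ind_scaleDl.

Lemma ind_valD (m m' : ind) : val (m + m') = val m + val m'.
Proof. by []. Qed.

(** The pure tensor b (x) x. *)
Definition tens (b : B) (x : M) : {ffun 'I_n -> M} := [ffun j => phi b j *: x].

Lemma ind_act_tens b c x : ind_act b (tens c x) = tens (b * c) x.
Proof.
apply/ffunP => j; rewrite !ffunE dual_coordM scaler_suml.
by apply: eq_bigr => i _; rewrite ffunE scalerA.
Qed.

Lemma tens_in b x : tens b x \in ind_pred.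
Proof. by apply/sepP; rewrite ind_act_tens mul1r. Qed.

Definition ind_tens b x : ind := exist _ (tens b x) (tens_in b x).

(** A generating family of M gives generators 1 (x) g_l. *)
Lemma ind_fg : finitely_generated M -> finitely_generated ind.
Proof.
move=> [k [g gP]]; exists k, (fun i => ind_tens 1 (g i)) => m.
have /choice[c cE] i : exists c : 'I_k -> A, val m i = \sum_l c l *: g l by exact: gP.
exists (fun l => \sum_i gam i * f (c i l)).
apply: val_inj; rewrite raddf_sum.
rewrite [RHS](eq_bigr (fun l => tens (\sum_i gam i * f (c i l)) (g l))); last first.
  by move=> l _; rewrite -[in RHS](mulr1 (\sum_i _)) -ind_act_tens.
apply/ffunP => j; rewrite -[in LHS](ind_valP m) sum_ffunE ffunE.
under eq_bigr do rewrite mul1r cE scaler_sumr.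
rewrite exchange_big; apply: eq_bigr => l _.
rewrite ffunE dual_coord_sum scaler_suml; apply: eq_bigr => i _.
by rewrite scalerA dual_coordZ.
Qed.

End Module.

Section Map.
Context (M N : lmodType A) (h : {linear M -> N}).

Definition map_pow (m : {ffun 'I_n -> M}) : {ffun 'I_n -> N} := [ffun i => h (m i)].

Lemma map_pow_act b m : map_pow (ind_act b m) = ind_act b (map_pow m).
Proof.
apply/ffunP => j; rewrite !ffunE linear_sum.
by apply: eq_bigr => i _; rewrite ffunE linearZ.
Qed.

Lemma map_pow_in (m : ind M) : map_pow (val m) \in @ind_pred N.
Proof. by apply/sepP; rewrite -map_pow_act ind_valP. Qed.

Lemma ind_map_linear :
  linear (fun m : ind M => exist _ (map_pow (val m)) (map_pow_in m) : ind N).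
Proof.
move=> b x y; apply: val_inj.
transitivity (map_pow (ind_act b (val x) + val y)) => //.
transitivity (ind_act b (map_pow (val x)) + map_pow (val y)) => //.
by rewrite -map_pow_act; apply/ffunP => j; rewrite !ffunE linearD.
Qed.

Definition ind_map : {linear ind M -> ind N} := linear_of ind_map_linear.

Lemma ind_mapE m : val (ind_map m) = map_pow (val m).
Proof. by []. Qed.

End Map.

(** Lifts are taken coordinatewise, then moved into the fixed points of the
    idempotent, which commutes with the coordinatewise action of u and v. *)
Lemma ind_exact (M1 M M2 : lmodType A) (u : {linear M1 -> M}) (v : {linear M -> M2}) :
  short_exact u v -> short_exact (ind_map u) (ind_map v).
Proof.
move=> [u_inj uv v_surj]; split.
- move=> x y /(congr1 val); rewrite !ind_mapE => /ffunP xy.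
  by apply/val_inj/ffunP => i; have := xy i; rewrite !ffunE => /u_inj.
- move=> x; split=> [vx|[y <-]]; last first.
    apply: val_inj; apply/ffunP => i; rewrite !ind_mapE !ffunE.
    by apply/uv; exists (val y i).
  have /choice[y yE] i : exists y, u y = val x i.
    by apply/uv; have /(congr1 val)/ffunP/(_ i) := vx; rewrite ind_mapE !ffunE.
  exists (ind_proj 1 (finfun y)); apply: val_inj; rewrite ind_mapE /= map_pow_act.
  rewrite -[RHS]ind_valP; congr (ind_act 1 _).
  by apply/ffunP => i; rewrite !ffunE.
- move=> z; have /choice[x xE] i : exists x, v x = val z i by exact: v_surj.
  exists (ind_proj 1 (finfun x)); apply: val_inj; rewrite ind_mapE /= map_pow_act.
  rewrite -[RHS]ind_valP; congr (ind_act 1 _).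
  by apply/ffunP => i; rewrite !ffunE.
Qed.

Definition induction : exact_functor A B.
Proof.
refine (@ExactFunctor A B (fun M => ind M) ind_map _ _ _ ind_exact ind_fg).
- by move=> M h hE m; apply/val_inj/ffunP => i; rewrite ind_mapE ffunE hE.
- by move=> M N X g h k kE m; apply/val_inj/ffunP => i; rewrite !ffunE kE.
- by move=> M N g h k kE m; apply/val_inj/ffunP => i; rewrite !ffunE kE.
Defined.

(** The multiplication map b (x) m |-> b m is B-linear, and m |-> 1 (x) m is an
    A-linear section of it. *)
Lemma ind_counit (M : lmodType B) :
  exists (p : {linear ind (restr f M) -> M})
    (s : {linear restr f M -> restr f (ind (restr f M))}),
  forall m, p (s m) = m.
Proof.
have p_lin : linear (fun m : ind (restr f M) => \sum_i gam i *: (val m i : M)).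
  move=> b x y; rewrite ind_valD.
  under eq_bigr do rewrite ffunE scalerDr.
  rewrite big_split /=; congr (_ + _); rewrite scaler_sumr.
  under [RHS]eq_bigr do rewrite scalerA (dual_sum db (b * _)) scaler_suml.
  rewrite exchange_big /=; apply: eq_bigr => j _; rewrite ffunE.
  rewrite scaler_sumr; apply: eq_bigr => i _.
  by rewrite -scalerA.
have s_lin : linear (fun m : restr f M => ind_tens 1 m : restr f (ind (restr f M))).
  move=> a x y; apply: val_inj.
  transitivity (ind_act (f a) (tens 1 x) + tens 1 y
    : {ffun 'I_n -> restr f M}) => //.
  rewrite ind_act_tens mulr1; apply/ffunP => j; rewrite !ffunE scalerDr; congr (_ + _).
  by rewrite scalerA -dual_coordZ mul1r.
exists (linear_of p_lin), (linear_of s_lin) => m /=.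
under eq_bigr do rewrite ffunE -[_ *: m]/(f _ *: (m : M)) scalerA.
by rewrite -scaler_suml -dual_sum scale1r.
Qed.

End Induction.

(** * Weak excellent and excellent extensions *)

Lemma retract_of_complement (A : pzRingType) (X M : lmodType A) (p : {linear X -> M}) :
  (forall m, exists x, p x = m) ->
  has_complement (ker_of p predT) -> retract M X.
Proof.
move=> p_surj [L [hL capL sumL]].
have /choice[s sP] m : exists x, x \in L /\ p x = m.
  have [x <-] := p_surj m; have [y [z [/ker_ofP[_ py] Lz ->]]] := sumL x.
  by exists z; rewrite linearD py add0r.
have s_lin : linear s.
  move=> a x y; apply/eqP; rewrite -subr_eq0; apply/eqP/capL.
    apply/ker_ofP; split=> //.
    by rewrite linearB linearP !(sP _).2 subrr.
  apply: submoduleB => //; first by case: (sP (a *: x + y)).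
  by apply: submoduleP => //; [case: (sP x) | case: (sP y)].
by exists (linear_of s_lin), p => m; case: (sP m).
Qed.

Lemma split_complement (A : pzRingType) (X M : lmodType A) (p : {linear X -> M})
    (s : {linear M -> X}) : (forall m, p (s m) = m) -> has_complement (ker_of p predT).
Proof.
move=> ps; exists (image_of s predT); split.
- by apply: image_submodule.
- by move=> x /ker_ofP[_ px] /image_ofP[m _ smx]; rewrite -smx -[m]ps smx px linear0.
- move=> x; exists (x - s (p x)), (s (p x)); rewrite subrK; split=> //.
    by apply/ker_ofP; rewrite linearB ps subrr.
  by apply/image_ofP; exists (p x).
Qed.

(** Over L the kernel of p has the image of s as a complement, so by relative
    projectivity it has a complement over G. *)
Lemma relatively_projective_retract (L G : pzRingType) (f : {rmorphism L -> G})
    (X M : lmodType G^c) (p : {linear X -> M})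
    (s : {linear right_restr f M -> right_restr f X}) :
  relatively_projective f -> (forall m, p (s m) = m) -> retract M X.
Proof.
move=> relp ps; apply: (retract_of_complement (p := p)).
  by move=> m; exists (s m).
apply: relp; first exact: ker_of_submodule.
exact: (@split_complement _ _ _ (@restr_linear L^c G^c (converse_mor f) X M p) s ps).
Qed.

(** Lifting the identity along a surjection from a free module. *)
Lemma projective_dual_basis (L G : pzRingType) (f : {rmorphism L -> G}) :
  finitely_generated (left_reg f) -> projective (left_reg f) ->
  exists n, inhabited (@dual_basis L^c G^c (converse_mor f) n).
Proof.
move=> /[dup] [[n [g gP]]] fgG projG.
have [h hE] := linear_comb g.
have [|k kE] := projG _ _ h idfun.
  move=> y; have [c ->] := gP y; exists (finfun c); rewrite hE.
  by apply: eq_bigr => i _; rewrite ffunE.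
exists n; constructor.
refine (@DualBasis L^c G^c (converse_mor f) n g (fun x i => k x i) _ _ _).
- by move=> x y i; rewrite linearD ffunE.
- move=> x a i; have /ffunP/(_ i) : k ((a : L) *: (x : left_reg f)) = (a : L) *: k x
    by exact: linearZ.
  by rewrite ffunE.
- by move=> x; rewrite -[LHS](kE x) hE.
Qed.

Lemma basis_dual_basis (L G : pzRingType) (f : {rmorphism L -> G}) n (g : 'I_n -> G) :
  is_basis (g : 'I_n -> left_reg f) ->
  exists db : @dual_basis L^c G^c (converse_mor f) n,
    dual_gen db = g /\ forall i j a, dual_coord db (f a * g i) j = (i == j)%:R * a.
Proof.
move=> gP.
have /choice[c cP] x : exists c : {ffun 'I_n -> L}, x = \sum_i f (c i) * g i.
  by have [c [xE _]] := gP x; exists c.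
have cU x d : x = \sum_i f (d i) * g i -> c x =1 d.
  move=> xE i; have [e [_ eU]] := gP x.
  rewrite -(ffunE d i).
  have <- : e = [ffun i => d i].
    by apply: eU; rewrite xE; apply: eq_bigr => j _; rewrite ffunE.
  by rewrite (eU _ (cP x)).
have cD x y i : c (x + y) i = c x i + c y i.
  apply: (cU _ (fun i => c x i + c y i)).
  rewrite {1}(cP x) {1}(cP y) -big_split; apply: eq_bigr => j _.
  by rewrite rmorphD mulrDl.
have cZ a x i : c (f a * x) i = a * c x i.
  apply: (cU _ (fun i => a * c x i)).
  rewrite {1}(cP x) mulr_sumr; apply: eq_bigr => j _.
  by rewrite rmorphM mulrA.
exists (@DualBasis L^c G^c (converse_mor f) n g (fun x i => c x i) cD
  (fun x a i => cZ a x i) cP); split=> // i j a /=.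
rewrite (cU _ (fun j => (i == j)%:R * a)) //.
rewrite (bigD1 i) //= eqxx mul1r big1 ?addr0 // => k ki.
by rewrite eq_sym (negbTE ki) mul0r rmorph0 mul0r.
Qed.

Lemma weak_excellent_generated (L G : pzRingType) (f : {rmorphism L -> G}) k :
  finitely_generated (left_reg f) -> weak_excellent f ->
  generated_in L^c k -> generated_in G^c k.
Proof.
move=> fgG [relp fgr _ projG] [T genT].
have [n [db]] := projective_dual_basis fgG projG.
pose F := induction db; exists (fgmap F T) => M.
pose MA : fgmod L^c := FGMod (@restr_fg L^c G^c (converse_mor f) M fgr (fgmodP M)).
apply: (@layer_retract _ _ _ (fgmap F MA)); last exact: functor_layer.
have [p [s ps]] := ind_counit db M.
exact: relatively_projective_retract relp ps.
Qed.

(** The map t, defined by f m g = g f (t m), is multiplicative because g can be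
    moved across a product one factor at a time; freeness of g on the right makes
    it well defined, and freeness on the left makes it injective. *)
Lemma normalizing_twist (L G : pzRingType) (f : {rmorphism L -> G}) n
    (g : 'I_n -> G) (i : 'I_n) :
  is_basis (g : 'I_n -> right_reg f) -> is_basis (g : 'I_n -> left_reg f) ->
  range (fun l => f l * g i) = range (fun l => g i * f l) ->
  exists (s : L -> L) (t : {rmorphism L -> L}),
    [/\ cancel s t, cancel t s & forall l, g i * f l = f (s l) * g i].
Proof.
move=> gr gl rangeE.
have free_r a b : g i * f a = g i * f b -> a = b.
  move=> ab; have [c [_ cU]] := gr (g i * f a).
  pose d (x : L) : {ffun 'I_n -> L} := [ffun j => if j == i then x else 0].
  have dE x : g i * f x = \sum_j (d x j : L^c) *: (g j : right_reg f).
    rewrite (bigD1 i) //= big1 => [|j ji]; first by rewrite ffunE eqxx addr0.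
    by rewrite ffunE (negbTE ji) scale0r.
  have := etrans (esym (cU _ (dE a))) (cU _ (etrans ab (dE b))).
  by move=> /ffunP/(_ i); rewrite !ffunE eqxx.
have free_l a b : f a * g i = f b * g i -> a = b.
  move=> ab; have [c [_ cU]] := gl (f a * g i).
  pose d (x : L) : {ffun 'I_n -> L} := [ffun j => if j == i then x else 0].
  have dE x : f x * g i = \sum_j (d x j) *: (g j : left_reg f).
    rewrite (bigD1 i) //= big1 => [|j ji]; first by rewrite ffunE eqxx addr0.
    by rewrite ffunE (negbTE ji) scale0r.
  have := etrans (esym (cU _ (dE a))) (cU _ (etrans ab (dE b))).
  by move=> /ffunP/(_ i); rewrite !ffunE eqxx.
have /choice[s sE] l : exists m, g i * f l = f m * g i.
  have : range (fun l => g i * f l) (g i * f l) by exists l.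
  by rewrite -rangeE => -[m _ mE]; exists m.
have /choice[t tE] l : exists m, f l * g i = g i * f m.
  have : range (fun l => f l * g i) (f l * g i) by exists l.
  by rewrite rangeE => -[m _ mE]; exists m.
have t_zmod : zmod_morphism t.
  by move=> a b; apply: free_r; rewrite -tE !rmorphB mulrBl mulrBr !tE.
have t_mon : monoid_morphism t.
  split=> [|a b]; apply: free_r; first by rewrite -tE !rmorph1 mulr1 mul1r.
  by rewrite -tE !rmorphM -mulrA tE !mulrA tE.
exists s, (HB.pack t (GRing.isZmodMorphism.Build _ _ t t_zmod)
  (GRing.isMonoidMorphism.Build _ _ t t_mon) : {rmorphism L -> L}).
split=> // l /=; first by apply: free_r; rewrite -tE sE.
by apply: free_l; rewrite -sE tE.
Qed.

(** The coordinate along g_0 is linear from the restricted induced module to M,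
    because g_i l has no component along g_0 when i is not 0, and the scalar s(l)
    by which l acts on that component is undone by the twist. *)
Lemma excellent_generated (L G : nzRingType) (f : {rmorphism L -> G}) k :
  excellent f -> generated_in G^c k -> generated_in L^c k.
Proof.
move=> [[_ fgr _ _] [n [g [gr gl rangeE]]]] [T genT].
case: n => [|n] in g gr gl rangeE.
  have [c [/esym/eqP + _]] := gl 1.
  by rewrite big_ord0 eq_sym oner_eq0.
have [s [t [sK tK sE]]] := normalizing_twist gr gl (rangeE ord0).
have [db [dbg dbE]] := basis_dual_basis gl.
pose F := induction db.
pose H := @restriction L^c G^c (converse_mor f) fgr.
exists (fgmap H T) => M.
pose twist : lmodType L^c := @restr L^c L^c (converse_mor t) M.
have fg_twist : finitely_generated twist.
  have [m [h hP]] := fgmodP M; exists m, h => x; have [c ->] := hP x.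
  exists (fun i => s (c i)); apply: eq_bigr => i _.
  by rewrite -{1}[c i]sK.
pose M' : fgmod L^c := FGMod fg_twist.
apply: (@layer_retract _ _ _ (fgmap H (fgmap F M'))); last exact/functor_layer.
have coord0 (a : L) j :
    dual_coord db ((f a : G^c) * dual_gen db ord0 : G^c) j = (ord0 == j)%:R * s a.
  by rewrite dbg -dbE -sE.
have coord_n0 (a : L) i : i != ord0 ->
    dual_coord db ((f a : G^c) * dual_gen db i : G^c) ord0 = 0.
  move=> i0; have : range (fun l => g i * f l) (g i * f a) by exists a.
  rewrite -rangeE dbg => -[m _ mE].
  by rewrite -[_ * _]/(g i * f a) -mE dbE (negbTE i0) mul0r.
have twistZ (a : L^c) (x : M) : a *: (x : twist) = (t a : L^c) *: x by [].
have p_lin : linear (fun m : @restr L^c G^c (converse_mor f) (ind db twist) =>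
    (val m ord0 : M)).
  move=> a x y; rewrite ffunE; congr (_ + _).
  rewrite [LHS]ffunE (bigD1 ord0) //= big1 ?addr0; last first.
    by move=> i i0; rewrite coord_n0 // scale0r.
  by rewrite coord0 eqxx mul1r twistZ sK.
have gam0 j : dual_coord db (dual_gen db ord0) j = (ord0 == j)%:R.
  by rewrite dbg -[g ord0]mul1r -(rmorph1 f) dbE mulr1.
have i_lin : linear (fun x : M => ind_tens db (dual_gen db ord0) (x : twist)
    : @restr L^c G^c (converse_mor f) (ind db twist)).
  move=> a x y; apply: val_inj; apply/ffunP => j.
  transitivity (dual_coord db ((f a : G^c) * dual_gen db ord0 : G^c) j *: (x : twist)
    + dual_coord db (dual_gen db ord0) j *: (y : twist)); last first.
    rewrite ffunE; congr (_ + _); last by rewrite ffunE.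
    have /ffunP/(_ j) := ind_act_tens db (f a : G^c) (dual_gen db ord0) (x : twist).
    by rewrite [X in _ = X -> _]ffunE => <-.
  rewrite ffunE coord0 gam0; case: (ord0 == j).
    by rewrite mul1r !scale1r !twistZ sK.
  by rewrite mul0r !scale0r addr0.
exists (linear_of i_lin), (linear_of p_lin) => x.
by rewrite /= ffunE gam0 eqxx scale1r.
Qed.

(** * The radical of an artinian ring *)

Section Radical.
Context (L : pzRingType).
Local Notation A := (L^c)^o.

Definition rad_pred : {pred A} := jacobson_radical L.

Lemma rad_predP x :
  reflect (forall I : {pred A}, maximal_right_ideal I -> x \in I) (x \in rad_pred).
Proof. exact: asboolP. Qed.

Lemma rad_submodule : submodule rad_pred.
Proof.
split; first by apply/rad_predP => I [hI _ _]; exact: submodule0.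
move=> a x y /rad_predP xJ /rad_predP yJ; apply/rad_predP => I mI.
by have [hI _ _] := mI; apply: submoduleP => //; [exact: xJ | exact: yJ].
Qed.

(** I + A x is the whole ring. *)
Lemma maximal_cover (I : {pred A}) (x y : A) :
  maximal_right_ideal I -> x \notin I -> exists a : L^c, y - a *: x \in I.
Proof.
move=> [hI _ maxI] xI; apply: contrapT => nya.
pose K : {pred A} := sep (fun z => exists a : L^c, z - a *: x \in I).
have hK : submodule K.
  split=> [|a u v /sepP[b ub] /sepP[c vc]]; apply/sepP.
    by exists 0; rewrite scale0r subr0 submodule0.
  exists (a * b + c).
  have -> : a *: u + v - (a * b + c) *: x = a *: (u - b *: x) + (v - c *: x).
    by rewrite scalerBr scalerDl scalerA opprD addrACA.
  exact: submoduleP.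
have KI : {subset K <= I}.
  apply: maxI => //; first by move=> z Iz; apply/sepP; exists 0; rewrite scale0r subr0.
  by exists y; apply/negP => /sepP.
by case/negP: xI; apply: KI; apply/sepP; exists 1; rewrite scale1r subrr submodule0.
Qed.

Hypothesis artA : artinian_module A.

(** Every submodule of a free module has a complement modulo the radical.  Take N
    minimal with N + K everything.  If x in N and K had a coordinate x_i outside a
    maximal ideal I, then the elements of N with i-th coordinate in I would
    already be enough, since N can be corrected by multiples of x, which lie
    in K.  The map s sends a basis vector to its component in N. *)
Lemma split_modulo_radical m (K : {pred {ffun 'I_m -> A}}) :
  submodule K ->
  exists s : {linear {ffun 'I_m -> A} -> {ffun 'I_m -> A}},
    (forall x, x - s x \in K) /\ (forall x, x \in K -> forall i, s x i \in rad_pred).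
Proof.
move=> hK.
have [|N [hN sumN minN]] := artinian_min
    (P := fun N : {pred {ffun 'I_m -> A}} =>
      forall x, exists2 y, y \in N & x - y \in K)
    (artinian_pow artA).
  by exists (fun=> true); split=> // x; exists x; rewrite // subrr submodule0.
have radN x : x \in N -> x \in K -> forall i, x i \in rad_pred.
  move=> Nx Kx i; apply/rad_predP => I mI; apply: contrapT => /negP xI.
  have [hI _ _] := mI.
  pose N' : {pred {ffun 'I_m -> A}} := sep (fun y => y \in N /\ y i \in I).
  have hN' : submodule N'.
    split=> [|a y z /sepP[Ny yI] /sepP[Nz zI]]; apply/sepP.
      by rewrite ffunE !submodule0.
    by rewrite !ffunE; split; exact: submoduleP.
  suff /(_ x Nx)/sepP[_ xiI] : {subset N <= N'} by rewrite xiI in xI.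
  apply: minN => //; last by move=> y /sepP[].
  move=> y; have [z Nz yzK] := sumN y.
  have [a zaI] := maximal_cover (z i) mI xI.
  exists (z - a *: x).
    apply/sepP; rewrite !ffunE; split=> //.
    by apply: submoduleB => //; exact: submoduleZ.
  by rewrite opprB addrCA addrC; apply: submoduleD => //; exact: submoduleZ.
pose e (i : 'I_m) : {ffun 'I_m -> A} := [ffun j => (i == j)%:R].
have /choice[l lP] i : exists y, y \in N /\ e i - y \in K.
  by have [y Ny Ky] := sumN (e i); exists y.
have [s sE] := linear_comb l.
have sK x : x - s x \in K.
  have -> : x - s x = \sum_i (x i : L^c) *: (e i - l i).
    rewrite sE; under [RHS]eq_bigr do rewrite scalerBr.
    rewrite sumrB; congr (_ - _).
    apply/ffunP => j; rewrite sum_ffunE (bigD1 j) //= big1 => [|i ij].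
      by rewrite !ffunE eqxx addr0 [RHS]mulr1.
    by rewrite !ffunE (negbTE ij) scaler0.
  by apply: submodule_sum => // i; case: (lP i).
exists s; split=> // x Kx; apply: radN.
  by rewrite sE; apply: submodule_sum => // i; case: (lP i).
by rewrite -[s x](subKr x); exact: submoduleB.
Qed.

Definition rad_mod : lmodType L^c := submod rad_submodule.
Definition top_mod : lmodType L^c := quotmod rad_submodule.

(** A presentation p of X by a free module kills J times that module, so p factors
    through a power of A/J, and the map s of the previous lemma splits it. *)
Lemma semisimple_top (X : lmodType L^c) :
  finitely_generated X ->
  (forall (a : L^c) (x : X), a \in rad_pred -> a *: x = 0) ->
  exists m, retract X {ffun 'I_m -> top_mod}.
Proof.
move=> [m [g gP]] JX; exists m.
have [p pE] := linear_comb g.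
have p_surj x : exists c, p c = x.
  have [c ->] := gP x; exists (finfun c); rewrite pE.
  by apply: eq_bigr => i _; rewrite ffunE.
have hker : submodule (ker_of p predT) by exact: ker_of_submodule.
have [s [sp sJ]] := split_modulo_radical hker.
pose q := quotmod_pi rad_submodule.
have q_lin : linear (fun c : {ffun 'I_m -> A} =>
    [ffun i => q (c i)] : {ffun 'I_m -> top_mod}).
  by move=> a x y; apply/ffunP => i; rewrite !ffunE linearP.
pose qm := linear_of q_lin.
have qm_surj y : exists c, qm c = y.
  have /choice[c cE] i : exists c, q c = y i by exact: quotmod_pi_surj.
  by exists (finfun c); apply/ffunP => i; rewrite !ffunE.
have [u uE] : exists u : {linear X -> {ffun 'I_m -> top_mod}},
    forall c, u (p c) = qm (s c).
  apply: (factor_surj (g := qm \o s)) => // c pc; apply/ffunP => i.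
  by rewrite !ffunE; apply/quotmod_pi_ker/sJ/ker_ofP.
have [v vE] : exists v : {linear {ffun 'I_m -> top_mod} -> X},
    forall c, v (qm c) = p c.
  apply: (factor_surj (g := p)) => // c /ffunP qc; rewrite pE big1 // => i _.
  apply: JX; apply/(quotmod_pi_ker rad_submodule).
  by have := qc i; rewrite !ffunE.
exists u, v => x; have [c <-] := p_surj x; rewrite uE vE.
have /ker_ofP[_] := sp c; rewrite linearB => /eqP.
by rewrite subr_eq0 => /eqP.
Qed.

(** The section is y |-> (s y, y) and the retraction (j, x) |-> j + (x - s x). *)
Lemma radical_syzygy m (K : {pred {ffun 'I_m -> A}}) (hK : submodule K) :
  (forall x : {ffun 'I_m -> A}, (forall i, x i \in rad_pred) -> x \in K) ->
  retract (submod hK) {ffun 'I_m -> (rad_mod * A)%type}.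
Proof.
move=> JK; have [s [sK sJ]] := split_modulo_radical hK.
have sJ' (k : submod hK) i : exists j : rad_mod,
    submod_val rad_submodule j = s (submod_val hK k) i.
  by apply: submod_valK; apply: sJ; exact: submod_valP.
have /choice[u uE] (k : submod hK) : exists y : {ffun 'I_m -> (rad_mod * A)%type},
    forall i, submod_val rad_submodule (y i).1 = s (submod_val hK k) i /\
      (y i).2 = submod_val hK k i.
  have /choice[j jE] := sJ' k.
  exists [ffun i => (j i, submod_val hK k i)] => i.
  by rewrite ffunE; split=> //; exact: jE.
have u_lin : linear u.
  move=> a x y; apply/ffunP => i; have [e1 e2] := uE (a *: x + y) i.
  have [x1 x2] := uE x i; have [y1 y2] := uE y i.
  apply: injective_projections; rewrite !ffunE.
    apply: submod_val_inj; rewrite e1 [in RHS]linearP x1 y1 !linearP.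
    by rewrite !ffunE.
  by rewrite e2 linearP !ffunE /= x2 y2.
have w1_lin : linear (fun y : {ffun 'I_m -> (rad_mod * A)%type} =>
    [ffun i => submod_val rad_submodule (y i).1] : {ffun 'I_m -> A}).
  by move=> a x y; apply/ffunP => i; rewrite !ffunE linearP.
have w2_lin : linear (fun y : {ffun 'I_m -> (rad_mod * A)%type} =>
    [ffun i => (y i).2] : {ffun 'I_m -> A}).
  by move=> a x y; apply/ffunP => i; rewrite !ffunE.
pose w1 := linear_of w1_lin; pose w2 := linear_of w2_lin.
have vK y : (w1 \+ (w2 \- (s \o w2))) y \in K.
  apply: submoduleD => //; last exact: sK.
  by apply: JK => i; rewrite ffunE; exact: (submod_valP (y i).1).
have [v vE] := lift_submod hK vK.
exists (linear_of u_lin), v => k; apply: submod_val_inj; rewrite vE /=.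
have -> : [ffun i => (u k i).2] = submod_val hK k.
  by apply/ffunP => i; rewrite ffunE; case: (uE k i).
have -> : [ffun i => submod_val rad_submodule (u k i).1] = s (submod_val hK k).
  by apply/ffunP => i; rewrite ffunE; case: (uE k i).
by rewrite subrKC.
Qed.

End Radical.

(** * Modules of homomorphisms *)

(** Endomorphisms of U on which B acts from the right, so that Hom(U, M) is a left
    B-module. *)
Record right_action (A B : pzRingType) (U : lmodType A) := RightAction {
  ract :> B -> {linear U -> U};
  ract1 : forall u, ract 1 u = u;
  ractM : forall b c u, ract (b * c) u = ract c (ract b u);
  ractD : forall b c u, ract (b + c) u = ract b u + ract c u
}.

Section HomModule.
Context (A B : pzRingType) (U : lmodType A) (act : right_action B U) (M : lmodType A).

(** The action is an argument so that the carrier of the B-module determines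
    it. *)
Definition hom_pred of right_action B U : {pred U -> M} :=
  sep (fun h : U -> M => linear h).

Lemma hom_pred_zmod : zmod_closed (hom_pred act).
Proof.
split=> [|h k /sepP h_lin /sepP k_lin]; apply/sepP => a x y.
  by rewrite /= scaler0 addr0.
transitivity (h (a *: x + y) - k (a *: x + y)) => //.
transitivity (a *: (h x - k x) + (h y - k y)) => //.
by rewrite h_lin k_lin scalerBr opprD addrACA.
Qed.

HB.instance Definition _ := GRing.isZmodClosed.Build _ (hom_pred act) hom_pred_zmod.

Definition hom_mod : Type := {h : U -> M | hom_pred act h}.
HB.instance Definition _ := SubType.on hom_mod.
HB.instance Definition _ := Choice.on hom_mod.
HB.instance Definition _ := [SubChoice_isSubZmodule of hom_mod by <:].

Lemma hom_mod_linear (h : hom_mod) : linear (val h).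
Proof. by have /sepP := valP h. Qed.

Lemma hom_act_in b (h : hom_mod) : (val h \o act b) \in hom_pred act.
Proof. by apply/sepP => a x y /=; rewrite linearP hom_mod_linear. Qed.

Let scale b (h : hom_mod) : hom_mod := exist _ (val h \o act b) (hom_act_in b h).

Lemma hom_eqP (h k : hom_mod) : (forall u, val h u = val k u) -> h = k.
Proof. by move=> hk; apply/val_inj/funext. Qed.

Fact hom_scaleA b c h : scale b (scale c h) = scale (b * c) h.
Proof. by apply: hom_eqP => u /=; rewrite ractM. Qed.

Fact hom_scale1 : left_id 1 scale.
Proof. by move=> h; apply: hom_eqP => u /=; rewrite ract1. Qed.

Fact hom_scaleDr : right_distributive scale +%R.
Proof. by move=> b h k; apply: hom_eqP. Qed.

Fact hom_scaleDl h : {morph scale^~ h : b c / b + c}.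
Proof.
move=> b c; apply: hom_eqP => u; rewrite /= ractD.
exact: (linearD (linear_of (hom_mod_linear h))).
Qed.

HB.instance Definition _ := GRing.Zmodule_isLmodule.Build B hom_mod
  hom_scaleA hom_scale1 hom_scaleDr hom_scaleDl.

Definition hom_val (h : hom_mod) : {linear U -> M} := linear_of (hom_mod_linear h).

Lemma hom_valZ b h u : hom_val (b *: h) u = hom_val h (act b u).
Proof. by []. Qed.

Lemma hom_valD h k u : hom_val (h + k) u = hom_val h u + hom_val k u.
Proof. by []. Qed.

Lemma hom_mod_intro (g : {linear U -> M}) : exists h, forall u, hom_val h u = g u.
Proof.
have g_in : (g : U -> M) \in hom_pred act by apply/sepP => a x y; rewrite linearP.
by exists (exist _ (g : U -> M) g_in).
Qed.

Lemma hom_valI h k : (forall u, hom_val h u = hom_val k u) -> h = k.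
Proof. exact: hom_eqP. Qed.

End HomModule.

(** * Artin algebras *)

Section ScalarAlgebra.
Context (R : comNzRingType) (L : algType R).

(** Finiteness is checked over the ground ring: a module over the algebra that is
    finitely generated over R has both chain conditions there, hence also for the
    fewer submodules over the algebra. *)
Definition scalar_mor (r : R) : L^c := r%:A.

Fact scalar_mor_zmod : zmod_morphism scalar_mor.
Proof. by move=> r s; rewrite /scalar_mor scalerBl. Qed.

Fact scalar_mor_monoid : monoid_morphism scalar_mor.
Proof.
split=> [|r s]; first exact: scale1r.
suff : (r * s)%:A = s%:A * r%:A :> L by [].
by rewrite -scalerAl mul1r scalerA mulrC.
Qed.

HB.instance Definition _ := GRing.isZmodMorphism.Build R L^c scalar_mor scalar_mor_zmod.
HB.instance Definition _ :=
  GRing.isMonoidMorphism.Build R L^c scalar_mor scalar_mor_monoid.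

Definition over_scalars (M : lmodType L^c) : lmodType R := @restr R L^c scalar_mor M.

Hypothesis artL : artin_algebra L.

Lemma over_scalars_fg M : finitely_generated M -> finitely_generated (over_scalars M).
Proof.
apply: restr_fg; have [_ [n [g gP]]] := artL; exists n, g => x.
have [c xE] := gP x; exists c; rewrite [LHS]xE; apply: eq_bigr => i _.
suff : c i *: g i = g i * (c i)%:A by [].
by rewrite -scalerAr mulr1.
Qed.

Lemma over_scalars_noetherian M :
  finitely_generated M -> noetherian_module (over_scalars M).
Proof.
by move=> fgM; apply: fg_noetherian (over_scalars_fg fgM); apply: hopkins; case: artL.
Qed.

Lemma artin_noetherian (M : lmodType L^c) : finitely_generated M -> noetherian_module M.
Proof. by move=> /over_scalars_noetherian/noetherian_of_restr. Qed.

Lemma artin_artinian : artinian_module (L^c)^o.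
Proof.
apply/artinian_of_restr/fg_artinian/over_scalars_fg/fg_free1.
by case: artL.
Qed.

End ScalarAlgebra.

Lemma left_reg_fg (R : comNzRingType) (L G : algType R) (f : {lrmorphism L -> G}) :
  artin_algebra G -> finitely_generated (left_reg f).
Proof.
move=> [_ [n [g gP]]]; exists n, g => x; have [c xE] := gP x.
exists (fun i => (c i)%:A); rewrite [LHS]xE; apply: eq_bigr => i _.
suff : c i *: g i = f (c i)%:A * g i by [].
by rewrite linearZ rmorph1 -scalerAl mul1r.
Qed.

Lemma right_reg_fg (R : comNzRingType) (L G : algType R) (f : {lrmorphism L -> G}) :
  artin_algebra G -> finitely_generated (right_reg f).
Proof.
move=> [_ [n [g gP]]]; exists n, g => x; have [c xE] := gP x.
exists (fun i => (c i)%:A); rewrite [LHS]xE; apply: eq_bigr => i _.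
suff : c i *: g i = g i * f (c i)%:A by [].
by rewrite linearZ rmorph1 -scalerAr mulr1.
Qed.

(** * Left idealized extensions *)

Section LeftIdealized.
Context (R : comNzRingType) (L G : algType R) (f : {lrmorphism L -> G}).
Hypotheses (f_inj : injective f) (artL : artin_algebra L) (artG : artin_algebra G).
Hypothesis idealf : left_idealized f.

Local Notation J := (rad_mod L).
Local Notation jval := (submod_val (rad_submodule L)).

Lemma rad_act_ex (b : G) (j : J) : exists k : J, f (jval k) = b * f (jval j) :> G.
Proof.
have : (f (jval j) : G^o) \in (fun x : G =>
    `[< exists2 l : L, l \in jacobson_radical L & f l = x >] : bool).
  by apply/asboolP; exists (jval j) => //; exact: (submod_valP j).
move=> /(submoduleZ idealf b)/asboolP[l Jl lE].
by have [k kE] := submod_valK (rad_submodule L) Jl; exists k; rewrite kE lE.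
Qed.

(** The left ideal property, read in the converse rings: G acts on J from the
    right by L^c-linear maps. *)
Lemma rad_action : exists act : right_action G^c J,
  forall (b : G) j, f (jval (act b j)) = b * f (jval j) :> G.
Proof.
have /choice[act actE] (bj : G * J) := rad_act_ex bj.1 bj.2.
have inj j k : f (jval j) = f (jval k) -> j = k.
  by move=> e; apply: (@submod_val_inj _ _ _ (rad_submodule L)); exact: f_inj.
have fD u v : f (jval (u + v)) = f (jval u) + f (jval v) by rewrite -rmorphD.
have act_lin b : linear (fun j : J => act (b, j)).
  move=> a x y; apply: inj; rewrite actE /=.
  have fE u v : f (jval (a *: u + v)) = f (jval u) * f a + f (jval v).
    by rewrite -rmorphM -rmorphD.
  by rewrite !fE !actE mulrDr mulrA.
unshelve eexists (@RightAction L^c G^c J (fun b => linear_of (act_lin b)) _ _ _).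
- by move=> u; apply: inj; rewrite /= actE mul1r.
- by move=> b c u; apply: inj; rewrite /= !actE mulrA.
- by move=> b c u; apply: inj; rewrite /= fD !actE mulrDl.
by move=> b j; exact: (actE (b, j)).
Qed.

Lemma rad_mod_fg : finitely_generated J.
Proof. exact/fg_submod/artin_noetherian/fg_free1. Qed.

Section ActionOnRadical.
Variable act : right_action G^c J.
Hypothesis actE : forall (b : G) j, f (jval (act b j)) = b * f (jval j) :> G.
Context (M : lmodType L^c).
Local Notation H := (hom_mod act M).

Lemma rad_valZ (a : L^c) (j : J) : jval (a *: j) = (jval j : L) * a :> L.
Proof. by []. Qed.

Lemma act_scalar (r : R) (j : J) : act (r%:A : G) j = scalar_mor L r *: j.
Proof.
apply/(@submod_val_inj _ _ _ (rad_submodule L))/f_inj.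
have -> : f (jval (scalar_mor L r *: j)) = f (jval j) * f r%:A by rewrite -rmorphM.
by rewrite actE linearZ rmorph1 -scalerAl -scalerAr mul1r mulr1.
Qed.

(** Evaluation at generators of J embeds H, over R, into a power of M. *)
Lemma hom_rad_fg : finitely_generated M -> finitely_generated H.
Proof.
move=> fgM; have [n [g gP]] := rad_mod_fg.
have ev_lin : linear (fun h : over_scalars H => [ffun i => hom_val h (g i)]
    : {ffun 'I_n -> over_scalars M}).
  move=> r h k; apply/ffunP => i; rewrite !ffunE hom_valD; congr (_ + _).
  transitivity (hom_val (h : H) (act (r%:A : G) (g i))) => //.
  by rewrite act_scalar linearZ.
have ev_inj : injective (linear_of ev_lin).
  move=> h k /ffunP hk; apply: hom_valI => u; have [c ->] := gP u.
  rewrite !linear_sum; apply: eq_bigr => i _; rewrite !linearZ; congr (_ *: _).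
  by have := hk i; rewrite !ffunE.
apply: (@fg_of_restr R G^c (scalar_mor G) H).
apply/noetherian_fg/(noetherian_inj ev_inj)/noetherian_pow.
exact: over_scalars_noetherian.
Qed.

Local Notation HL := (@restr L^c G^c (converse_mor f) H).

Lemma rad_unit : exists mu : {linear M -> HL},
  forall m j, hom_val (mu m : H) j = (jval j : L^c) *: m.
Proof.
have ev_lin (m : M) : linear (fun j : J => (jval j : L^c) *: m).
  by move=> a i j; rewrite linearP scalerDl scalerA.
have /choice[mu muE] (m : M) :
    exists h : H, forall j, hom_val h j = (jval j : L^c) *: m.
  by have [h hE] := hom_mod_intro act (linear_of (ev_lin m)); exists h.
have mu_lin : linear (mu : M -> HL).
  move=> a x y; apply: hom_valI => j.
  transitivity (hom_val (mu x) (act (f a) j) + hom_val (mu y) j) => //.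
  rewrite !muE scalerDr; congr (_ + _); rewrite scalerA; congr (_ *: _).
  apply: f_inj; rewrite actE; transitivity (f a * f (jval j)) => //.
  by rewrite -rmorphM.
by exists (linear_of mu_lin).
Qed.

(** The cokernel of mu is killed by J. *)
Lemma rad_cokernel (mu : {linear M -> HL}) (j : J) (h : HL) :
  (forall m i, hom_val (mu m : H) i = (jval i : L^c) *: m) ->
  (jval j : L^c) *: h = mu (hom_val (h : H) j).
Proof.
move=> muE; apply: hom_valI => i; rewrite muE hom_valZ.
have -> : act (f (jval j)) i = (jval i : L^c) *: j.
  apply/(@submod_val_inj _ _ _ (rad_submodule L))/f_inj.
  by rewrite actE rad_valZ rmorphM.
by rewrite linearZ.
Qed.

End ActionOnRadical.

(** The layers are met in the order that their definition prescribes: X and K are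
    submodules in the first layer, H is the last quotient. *)
Lemma left_idealized_generated k : generated_in G^c k -> generated_in L^c (k + 2).
Proof.
move=> [T' genT'].
have [act actE] := rad_action.
have noeth := @artin_noetherian R L artL.
have artA := @artin_artinian R L artL.
have fgA : finitely_generated (L^c)^o := fg_free1 _.
pose res := @restriction L^c G^c (converse_mor f) (right_reg_fg f artG).
pose TL : fgmod L^c := fgmap res T'.
have fgtop : finitely_generated (top_mod L).
  exact: (fg_image (u := quotmod_pi (rad_submodule L)) (@quotmod_pi_surj _ _ _ _)).
pose T : fgmod L^c :=
  FGMod (fg_prod (fg_prod fgtop (fg_prod rad_mod_fg fgA)) (fgmodP TL)).
exists T => M; rewrite addn2.
have [mu muE] := rad_unit actE M.
pose Hf : fgmod G^c := FGMod (hom_rad_fg actE (fgmodP M)).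
pose HL : fgmod L^c := fgmap res Hf.
have hI : submodule (image_of (mu : {linear M -> HL}) predT) by exact: image_submodule.
have hX : submodule (ker_of (mu : {linear M -> HL}) predT) by exact: ker_of_submodule.
pose X : fgmod L^c := FGMod (fg_submod hX (noeth M (fgmodP M))).
pose I : fgmod L^c := FGMod (fg_submod hI (noeth HL (fgmodP HL))).
have add_top : add (fun N => N = T) X.
  have [|m Xm] := semisimple_top artA (fgmodP X).
    move=> a x Ja; apply: (@submod_val_inj _ _ _ hX); rewrite linearZ linear0.
    have /ker_ofP[_ mux] := submod_valP x.
    have [j <-] := submod_valK (rad_submodule L) Ja.
    transitivity (hom_val (mu (submod_val hX x) : Hf) j); first exact/esym/muE.
    by rewrite mux.
  apply: (@add_mono_retract _ (FGMod fgtop) T X); last exact: (@add_pow _ _ _ m).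
  by apply: retract_trans (retract_fst _ _); exact: retract_fst.
have layer_I : layer T k.+2 I.
  have [m [g gP]] := fgmodP HL.
  have [sig sigE] := linear_comb g.
  have hK : submodule (preim_of sig (image_of (mu : {linear M -> HL}) predT)).
    exact: preim_submodule.
  have fgP : finitely_generated {ffun 'I_m -> (L^c)^o} by exact: fg_pow.
  pose K : fgmod L^c := FGMod (fg_submod hK (noeth _ fgP)).
  pose P : fgmod L^c := FGMod (fg_prod (fgmodP I) fgP).
  apply: (@layer_retract _ _ _ P); first exact: retract_fst.
  have add_K : add (fun N => N = T) K.
    apply: (@add_mono_retract _ (FGMod (fg_prod rad_mod_fg fgA)) T K).
      by apply: retract_trans (retract_fst _ _); exact: retract_snd.
    apply: (@add_pow _ _ _ m); apply: radical_syzygy => // x Jx.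
    apply/preim_ofP; rewrite sigE.
    elim/big_rec: _ => [|i y _ Iy]; first exact: submodule0.
    apply: submoduleD => //; apply/image_ofP.
    have [j <-] := submod_valK (rad_submodule L) (Jx i).
    exists (hom_val (g i : Hf) j) => //.
    exact: esym (rad_cokernel actE _ _ muE).
  have sig_surj z : exists c, sig c = z.
    have [c ->] := gP z; exists (finfun c); rewrite sigE.
    by apply: eq_bigr => l _; rewrite ffunE.
  have layer_HL : layer T k.+1 HL.
    apply: layer_mono (functor_layer _ (genT' Hf)).
    exact: retract_snd.
  have [i [p ip]] := preimage_exact hI hK sig_surj.
  exact: (@layer_extension _ T k K P HL i p add_K layer_HL ip).
have [v uv] := kernel_image_exact hX hI.
exact: (@layer_extension _ T k.+1 X M I (submod_val hX) v add_top layer_I uv).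
Qed.

End LeftIdealized.

(** * Comparison of the extension dimensions *)

Theorem theorem4p2 (R : comNzRingType) (Lambda Gamma : algType R)
    (iota : {lrmorphism Lambda -> Gamma}) (iota_inj : injective iota)
    (artin_Lambda : artin_algebra Lambda) (artin_Gamma : artin_algebra Gamma) :
  ((weak_excellent iota -> (dim_mod Lambda >= dim_mod Gamma)%E) /\
   (excellent iota -> dim_mod Lambda = dim_mod Gamma)) /\
  (left_idealized iota -> (dim_mod Lambda <= dim_mod Gamma + 2%:E)%E).
Proof.
have dimG_le : weak_excellent iota -> (dim_mod Gamma <= dim_mod Lambda)%E.
  move=> we; rewrite -[leRHS]adde0; apply: extension_dim_le => n; rewrite addn0.
  by apply: weak_excellent_generated we; exact: left_reg_fg.
split; last first.
  move=> idealf; apply: (@extension_dim_le _ _ 2) => n.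
  exact: (left_idealized_generated iota_inj artin_Lambda artin_Gamma idealf).
split=> // exc; apply/eqP; rewrite eq_le dimG_le ?andbT; last by case: exc.
rewrite -[leRHS]adde0; apply: extension_dim_le => n; rewrite addn0.
exact: excellent_generated exc.
Qed.
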